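(* Let $\phi(x)=\frac{ax+b}{cx+d}$ with $a,b,c,d\in\mathbb{Q}_2$, $ad-bc\ne0$, let $\Delta=(d-a)^2+4bc$ with $\sqrt{\Delta}\notin\mathbb{Q}_2$, and suppose that $\lambda=\frac{a+d+\sqrt{\Delta}}{a+d-\sqrt{\Delta}}$ is not a root of unity and that $\mathbb{Q}_2(\sqrt{\Delta})=\mathbb{Q}_2(\sqrt{i})$ where $i=-1$ or $3$. Let $r_0=|\sqrt{\Delta}/c|_2$, let $\eta\in\mathbb{Q}_2$ with $|\eta|_2=r_0$, and set $$h(x)=\eta x+\frac{a-d-2^{v_2(\sqrt{\Delta})}}{2c}.$$ If $(B,\phi)$ is a minimal subsystem of $(\mathbb{P}^1(\mathbb{Q}_2),\phi)$, then the unique invariant (Borel probability) measure $\overline\sigma$ of the system $(B,\phi)$ is given, for each measurable subset $A\subset B$, by $$\overline\sigma(A)=\frac{\overline\mu(h^{-1}(A))}{\overline\mu(h^{-1}(B))}.$$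
   Context: $\mathbb{P}^1(\mathbb{Q}_2)=\mathbb{Q}_2\cup\{\infty\}$ with its usual compact topology; $|\cdot|_2$ and $v_2=-\log_2|\cdot|_2$ are extended to $\mathbb{Q}_2(\sqrt\Delta)$ (in the present case $v_2(\sqrt\Delta)\in\mathbb{Z}$); $h$ is extended by $h(\infty)=\infty$. (The hypothesis $\sqrt\Delta\notin\mathbb{Q}_2$ forces $c\ne 0$.) A subsystem is a pair $(B,\phi)$ with $B$ nonempty compact and $\phi(B)\subset B$; it is minimal if $B=\overline{\{\phi^n(x):n\ge0\}}$ for every $x\in B$. Let $\mu_0$ be the Haar probability measure on $\mathbb{Z}_2$ and $\xi:\mathbb{P}^1(\mathbb{Q}_2)\to\mathbb{P}^1(\mathbb{Q}_2)$, $\xi(z)=1/z$. For a Borel set $S\subset\mathbb{P}^1(\mathbb{Q}_2)$ put $S_1=\mathbb{Z}_2\cap S$, $S_2=(\mathbb{P}^1(\mathbb{Q}_2)\setminus\mathbb{Z}_2)\cap S$ (so $\xi^{-1}(S_2)\subset 2\mathbb{Z}_2$), and define the probability measure $$\overline\mu(S):=\frac12\mu_0(S_1)+\mu_0(\xi^{-1}(S_2)).$$ *)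

(* Defs.v *)
From HB Require Import structures.
From mathcomp Require Import all_boot all_order all_algebra all_field.
From mathcomp Require Import generic_quotient ring_quotient.
From mathcomp Require Import all_classical all_reals all_analysis.
From mathcomp Require Import zify ring lra.

Set Implicit Arguments.
Unset Strict Implicit.
Unset Printing Implicit Defensive.

Import Order.TTheory GRing.Theory Num.Theory numFieldNormedType.Exports.

Local Open Scope classical_set_scope.
Local Open Scope ring_scope.
Local Open Scope quotient_scope.

Definition val2 (q : rat) : int :=
  (logn 2 `|numq q|)%:Z - (logn 2 `|denq q|)%:Z.

Definition abs2 (q : rat) : rat := if q == 0 then 0 else 2%:R ^ (- val2 q).

Local Lemma subz_cross (a b c d : nat) :
  (a + b = c + d)%N -> a%:Z - d%:Z = c%:Z - b%:Z.
Proof. lia. Qed.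

Local Lemma subzDD (a b c d : nat) :
  (a + b)%N%:Z - (c + d)%N%:Z = a%:Z - c%:Z + (b%:Z - d%:Z).
Proof. lia. Qed.

Lemma val2_frac (m n : int) : m != 0 -> n != 0 ->
  val2 (m%:~R / n%:~R) = (logn 2 `|m|)%:Z - (logn 2 `|n|)%:Z.
Proof.
move=> m0 n0; set q := m%:~R / n%:~R.
have q0 : q != 0 by rewrite mulf_neq0 ?invr_eq0 ?intr_eq0.
have nq0 : numq q != 0 by rewrite numq_eq0.
have E : numq q * n = m * denq q.
  apply: (@intr_inj rat); rewrite !rmorphM /= numqE /q.
  by rewrite mulrAC divfK ?intr_eq0.
have /(congr1 (logn 2)) : (`|numq q| * `|n| = `|m| * `|denq q|)%N.
  by rewrite -!abszM E.
by rewrite !lognM ?absz_gt0 ?denq_eq0 // => /subz_cross.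
Qed.

Lemma val2M (x y : rat) : x != 0 -> y != 0 -> val2 (x * y) = val2 x + val2 y.
Proof.
move=> x0 y0.
rewrite -{1}[x]divq_num_den -{1}[y]divq_num_den mulf_div -!rmorphM /=.
rewrite val2_frac ?mulf_neq0 ?numq_eq0 ?denq_eq0 // !abszM.
by rewrite !lognM ?absz_gt0 ?numq_eq0 ?denq_eq0 // subzDD.
Qed.

Lemma abs2_0 : abs2 0 = 0. Proof. by rewrite /abs2 eqxx. Qed.

Lemma abs2_1 : abs2 1 = 1.
Proof. by rewrite /abs2 oner_eq0. Qed.

Lemma abs2_gt0 (x : rat) : x != 0 -> 0 < abs2 x.
Proof. by move=> x0; rewrite /abs2 (negbTE x0) exprz_gt0. Qed.

Lemma abs2_ge0 (x : rat) : 0 <= abs2 x.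
Proof. by have [->|/abs2_gt0/ltW//] := eqVneq x 0; rewrite abs2_0. Qed.

Lemma abs2_eq0 (x : rat) : (abs2 x == 0) = (x == 0).
Proof.
by have [->|x0] := eqVneq x 0; rewrite ?abs2_0 ?eqxx// gt_eqF// abs2_gt0.
Qed.

Lemma abs2M (x y : rat) : abs2 (x * y) = abs2 x * abs2 y.
Proof.
have [->|x0] := eqVneq x 0; first by rewrite mul0r abs2_0 mul0r.
have [->|y0] := eqVneq y 0; first by rewrite mulr0 abs2_0 mulr0.
rewrite /abs2 mulf_eq0 (negbTE x0) (negbTE y0) /= val2M //.
by rewrite opprD expfzDr.
Qed.

Lemma abs2N (x : rat) : abs2 (- x) = abs2 x.
Proof. by rewrite /abs2 /val2 oppr_eq0 numqN denqN abszN. Qed.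

Lemma abs2B (x y : rat) : abs2 (x - y) = abs2 (y - x).
Proof. by rewrite -abs2N opprB. Qed.

Lemma abs2V (x : rat) : abs2 x^-1 = (abs2 x)^-1.
Proof.
have [->|x0] := eqVneq x 0; first by rewrite !(invr0, abs2_0).
apply: (mulfI (x := abs2 x)); first by rewrite abs2_eq0.
by rewrite -abs2M !divff ?abs2_eq0// abs2_1.
Qed.

Lemma abs2_intE (m : int) : m != 0 -> abs2 m%:~R = 2%:R ^- logn 2 `|m|.
Proof.
move=> m0; rewrite /abs2 intr_eq0 (negbTE m0).
have := val2_frac m0 (oner_neq0 int); rewrite rmorph1 divr1 => ->.
by rewrite logn1 subr0 exprnN.
Qed.

Lemma abs2_int (m : int) : abs2 m%:~R <= 1.
Proof.
have [->|m0] := eqVneq m 0; first by rewrite abs2_0.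
by rewrite abs2_intE // invf_le1 ?exprn_gt0// exprn_ege1.
Qed.

Lemma abs2_denq (z : rat) : abs2 z <= 1 -> abs2 (denq z)%:~R = 1.
Proof.
rewrite -{1}[z]divq_num_den abs2M abs2V (abs2_intE (denq_neq0 z)) invrK.
have [/logn_coprime -> _|] := boolP (coprime 2 `|denq z|).
  by rewrite expr0 invr1.
rewrite prime_coprime // negbK => d2.
have n2 : coprime 2 `|numq z|.
  by apply: coprime_dvdl d2 _; rewrite coprime_sym coprime_num_den.
have [nz0|nz0] := eqVneq (numq z) 0.
  by move: n2; rewrite nz0.
rewrite (abs2_intE nz0) (logn_coprime n2) expr0 invr1 mul1r leNgt.
have l0 : (0 < logn 2 `|denq z|)%N.
  by rewrite logn_gt0 mem_primes absz_gt0 denq_neq0 d2.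
by rewrite exprn_egt1 // -lt0n l0.
Qed.

Lemma abs2_1D (z : rat) : abs2 z <= 1 -> abs2 (1 + z) <= 1.
Proof.
move=> z1.
have -> : 1 + z = (denq z + numq z)%:~R / (denq z)%:~R.
  by rewrite rmorphD /= mulrDl divff ?intr_eq0 ?denq_eq0 // divq_num_den.
by rewrite abs2M abs2V (abs2_denq z1) invr1 mulr1 abs2_int.
Qed.

Lemma abs2D (x y : rat) : abs2 (x + y) <= Num.max (abs2 x) (abs2 y).
Proof.
wlog yx : x y / abs2 y <= abs2 x.
  by move=> W; case/orP: (le_total (abs2 y) (abs2 x)) => /W //; rewrite addrC maxC.
rewrite (max_idPl yx).
have [x0|x0] := eqVneq x 0.
  move: yx; rewrite x0 abs2_0 add0r => y0.
  by have /eqP := le_anti (introT andP (conj y0 (abs2_ge0 y))); rewrite eq_sym.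
have -> : x + y = x * (1 + y / x) by rewrite mulrDr mulr1 mulrCA divff ?mulr1.
rewrite abs2M ler_piMr ?abs2_ge0// abs2_1D// abs2M abs2V.
by rewrite ler_pdivrMr ?mul1r// abs2_gt0.
Qed.

Lemma abs2_lt (x y e : rat) : abs2 x < e -> abs2 y < e -> abs2 (x + y) < e.
Proof.
by move=> h1 h2; apply: le_lt_trans (abs2D x y) _; rewrite gt_max h1.
Qed.

Lemma abs2_isosceles (x y : rat) : abs2 (y - x) < abs2 x -> abs2 y = abs2 x.
Proof.
move=> h; apply/eqP; rewrite eq_le; apply/andP; split.
  by have := abs2D (y - x) x; rewrite subrK (max_idPr (ltW h)).
rewrite leNgt; apply/negP => yx.
have := abs2_lt yx (y := x - y) (e := abs2 x).
by rewrite (addrC y) subrK ltxx abs2B => /(_ h).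
Qed.

Lemma abs2_dist (x y : rat) : `|abs2 x - abs2 y| <= abs2 (x - y).
Proof.
have D a b : abs2 a <= abs2 (a - b) + abs2 b.
  rewrite -{1}(subrK b a); apply: le_trans (abs2D _ _) _.
  by rewrite ge_max lerDl lerDr !abs2_ge0.
by rewrite ler_norml lerBlDr D andbT lerNl opprB lerBlDr abs2B D.
Qed.

(** [Q2] is the completion of [rat] for [abs2]: the ring of Cauchy sequences
   modulo the ideal of null sequences. *)

Definition cauchy2 (u : nat -> rat) : Prop :=
  forall e : rat, 0 < e -> exists N : nat, forall m n : nat,
    (N <= m)%N -> (N <= n)%N -> abs2 (u m - u n) < e.

Definition null2 (u : nat -> rat) : Prop :=
  forall e : rat, 0 < e -> exists N : nat, forall n : nat,
    (N <= n)%N -> abs2 (u n) < e.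

Lemma cauchy2_bounded u : cauchy2 u ->
  exists N, exists2 M : rat, 0 < M & forall n, (N <= n)%N -> abs2 (u n) < M.
Proof.
move=> /(_ 1 ltr01) [N uN]; exists N, (1 + abs2 (u N)) => [|n Nn].
  by rewrite ltr_pwDl// abs2_ge0.
rewrite -(subrK (u N) (u n)); apply: abs2_lt.
  by apply: (lt_le_trans (uN _ _ Nn (leqnn N))); rewrite lerDl abs2_ge0.
by rewrite ltrDr.
Qed.

Definition cauchy2_pred : {pred (nat -> rat)} := fun u => `[< cauchy2 u >].

Lemma cauchy2_subring : subring_closed cauchy2_pred.
Proof.
split=> [|u v /asboolP uC /asboolP vC|u v /asboolP uC /asboolP vC]; apply/asboolP => e e0.
- by exists 0%N => m n _ _; rewrite subrr abs2_0.
- have [N uN] := uC e e0; have [N' vN] := vC e e0.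
  exists (maxn N N') => m n; rewrite !geq_max => /andP[m1 m2] /andP[n1 n2].
  have -> : (u - v) m - (u - v) n = (u m - u n) + (v n - v m).
    by rewrite -[(u - v) m]/(u m - v m) -[(u - v) n]/(u n - v n); ring.
  by apply: abs2_lt; [exact: uN | exact: vN].
- have [N1 [M1 M10 uM]] := cauchy2_bounded uC.
  have [N2 [M2 M20 vM]] := cauchy2_bounded vC.
  have [N uN] := uC _ (divr_gt0 e0 M20).
  have [N' vN] := vC _ (divr_gt0 e0 M10).
  exists (maxn (maxn N N') (maxn N1 N2)) => m n; rewrite !geq_max.
  move=> /andP[/andP[m1 m2] /andP[m3 m4]] /andP[/andP[n1 n2] /andP[n3 n4]].
  have -> : (u * v) m - (u * v) n = u m * (v m - v n) + (u m - u n) * v n.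
    by rewrite -[(u * v) m]/(u m * v m) -[(u * v) n]/(u n * v n); ring.
  apply: abs2_lt; rewrite abs2M.
    apply: le_lt_trans (_ : M1 * abs2 (v m - v n) < _).
      by rewrite ler_wpM2r ?abs2_ge0// ltW// uM.
    by rewrite mulrC -ltr_pdivlMr// vN.
  apply: le_lt_trans (_ : abs2 (u m - u n) * M2 < _).
    by rewrite ler_wpM2l ?abs2_ge0// ltW// vM.
  by rewrite -ltr_pdivlMr// uN.
Qed.

HB.instance Definition _ :=
  GRing.isSubringClosed.Build (nat -> rat) cauchy2_pred cauchy2_subring.

Record cauchySeq := CauchySeq {
  cseq :> nat -> rat ;
  cseqP : cseq \in cauchy2_pred }.

HB.instance Definition _ := [isSub for cseq].
HB.instance Definition _ := [Choice of cauchySeq by <:].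
HB.instance Definition _ := [SubChoice_isSubComNzRing of cauchySeq by <:].

Definition nullSeq : {pred cauchySeq} := fun u => `[< null2 u >].

Lemma nullSeq_idealr : idealr_closed nullSeq.
Proof.
split=> [||c u v /asboolP uC /asboolP vC].
- by apply/asboolP => e e0; exists 0%N => n _; rewrite abs2_0.
- apply/negP => /asboolP /(_ 1 ltr01) [N /(_ N (leqnn N))].
  by rewrite abs2_1 ltxx.
- apply/asboolP => e e0.
  have /asboolP/cauchy2_bounded [N1 [M M0 cM]] := cseqP c.
  have [N2 uN] := uC _ (divr_gt0 e0 M0).
  have [N3 vN] := vC _ e0.
  exists (maxn N1 (maxn N2 N3)) => n; rewrite !geq_max => /and3P[n1 n2 n3].
  rewrite /=; apply: abs2_lt; last exact: vN.
  rewrite abs2M; apply: le_lt_trans (_ : M * abs2 (u n) < _).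
    by rewrite ler_wpM2r ?abs2_ge0// ltW// cM.
  by rewrite mulrC -ltr_pdivlMr// uN.
Qed.

HB.instance Definition _ := isIdealr.Build cauchySeq nullSeq nullSeq_idealr.

Definition Q2 : Type := {ideal_quot nullSeq}.
HB.instance Definition _ := GRing.ComNzRing.on Q2.
HB.instance Definition _ := EqQuotient.on Q2.

Lemma Q2_pi0 : \pi_Q2 (0 : cauchySeq) = 0.
Proof. exact: (rmorph0 \pi_({ideal_quot nullSeq})). Qed.

Lemma Q2_pi1 : \pi_Q2 (1 : cauchySeq) = 1.
Proof. exact: (rmorph1 \pi_({ideal_quot nullSeq})). Qed.

Lemma Q2_piN (u : cauchySeq) : \pi_Q2 (- u) = - \pi_Q2 u.
Proof. exact: (rmorphN \pi_({ideal_quot nullSeq})). Qed.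

Lemma Q2_piD (u v : cauchySeq) : \pi_Q2 (u + v) = \pi_Q2 u + \pi_Q2 v.
Proof. exact: (rmorphD \pi_({ideal_quot nullSeq})). Qed.

Lemma Q2_piM (u v : cauchySeq) : \pi_Q2 (u * v) = \pi_Q2 u * \pi_Q2 v.
Proof. exact: (rmorphM \pi_({ideal_quot nullSeq})). Qed.

Lemma cauchySeqP (u : cauchySeq) : cauchy2 u.
Proof. exact/asboolP/cseqP. Qed.

Lemma eq_Q2 (u v : cauchySeq) :
  (\pi_Q2 u = \pi_Q2 v) <-> null2 (u - v : cauchySeq).
Proof.
have E := Quotient.idealrBE nullSeq u v.
split=> uv.
  by have /asboolP : u - v \in nullSeq by rewrite E; apply/eqP.
by apply/eqP; have : u - v \in nullSeq by [apply/asboolP]; rewrite E.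
Qed.

Lemma cauchy2_stable (u : nat -> rat) : cauchy2 u -> ~ null2 u ->
  exists2 r : rat, 0 < r &
    exists N, forall n, (N <= n)%N -> abs2 (u n) = r.
Proof.
move=> uC; rewrite -existsNP => -[e]; rewrite not_implyE -forallNP => -[e0 uN].
have [N NP] := uC e e0.
have [n0 n0P] : exists n, ~ ((N <= n)%N -> abs2 (u n) < e).
  by apply/existsNP; exact: uN.
move: n0P; rewrite not_implyE => -[Nn0 /negP]; rewrite -leNgt => en0.
exists (abs2 (u n0)); first exact: lt_le_trans en0.
exists N => n Nn; apply: abs2_isosceles.
exact: lt_le_trans (NP _ _ Nn Nn0) en0.
Qed.

Lemma cauchy2V (u : nat -> rat) : cauchy2 u -> ~ null2 u ->
  cauchy2 (fun n => (u n)^-1).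
Proof.
move=> uC /(cauchy2_stable uC)[r r0 [N uN]] e e0.
have [N' uN'] := uC _ (mulr_gt0 e0 (mulr_gt0 r0 r0)).
exists (maxn N N') => m n; rewrite !geq_max => /andP[m1 m2] /andP[n1 n2].
have nz k : (N <= k)%N -> u k != 0.
  by move=> Nk; rewrite -abs2_eq0 uN// gt_eqF.
have -> : (u m)^-1 - (u n)^-1 = (u n - u m) * ((u m)^-1 * (u n)^-1).
  by field; rewrite !nz.
rewrite !abs2M !abs2V !uN// -invfM -ltr_pdivlMr ?invr_gt0 ?mulr_gt0//.
by rewrite invrK uN'.
Qed.

Definition Q2_inv (x : Q2) : Q2 :=
  if x == 0 then 0
  else (\pi_Q2 (insubd (0 : cauchySeq) (fun n => (repr x n)^-1))).

Lemma Q2_mulVx (x : Q2) : x != 0 -> Q2_inv x * x = 1.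
Proof.
move=> x0; rewrite /Q2_inv (negbTE x0).
have xN : ~ null2 (repr x : cauchySeq).
  move=> xN; move/eqP: x0; apply.
  rewrite -[x]reprK -Q2_pi0; apply/eq_Q2.
  by rewrite subr0.
have vE : cseq (insubd (0 : cauchySeq) (fun n => (repr x n)^-1)) = (fun n => (repr x n)^-1).
  rewrite -[cseq _]/(val _) insubdK//.
  by apply/asboolP/cauchy2V => //; exact: cauchySeqP.
rewrite -{2}[x]reprK -Q2_piM -Q2_pi1; apply/eq_Q2 => e e0.
have [r r0 [N xr]] := cauchy2_stable (cauchySeqP (repr x)) xN.
exists N => n Nn.
rewrite -[X in abs2 X]/(cseq (insubd _ _) n * repr x n - 1) vE.
by rewrite mulVf ?subrr ?abs2_0// -abs2_eq0 xr ?gt_eqF.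
Qed.

Lemma Q2_inv0 : Q2_inv 0 = 0. Proof. by rewrite /Q2_inv eqxx. Qed.

HB.instance Definition _ := GRing.ComNzRing_isField.Build Q2 Q2_mulVx Q2_inv0.

(** |x|_2 = lim |u_n|_2 for any Cauchy sequence [u] representing [x]. *)
Definition absQ2 (x : Q2) : rat :=
  limn (fun n => abs2 ((repr x : cauchySeq) n) : rat^o).

Local Lemma rat_lim_uniq (f : nat -> rat^o) (a b : rat^o) :
  f @ \oo --> a -> f @ \oo --> b -> a = b.
Proof. by move=> /(cvg_lim (@norm_hausdorff _ _)) <- /(cvg_lim (@norm_hausdorff _ _)). Qed.

Lemma null2_cvg (u : nat -> rat) : null2 u ->
  (fun n => abs2 (u n) : rat^o) @ \oo --> (0 : rat^o).
Proof.
move=> u0; apply/cvgrPdist_lt => e e0; have [N uN] := u0 e e0.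
exists N => // n /= Nn.
by rewrite sub0r normrN ger0_norm ?abs2_ge0//; exact: uN.
Qed.

Lemma cauchy2_abs_cvg (u : nat -> rat) : cauchy2 u ->
  cvgn (fun n => abs2 (u n) : rat^o).
Proof.
move=> uC; have [/null2_cvg u0|uN] := pselect (null2 u).
  by apply/cvg_ex; exists 0.
have [r _ [N ur]] := cauchy2_stable uC uN.
apply/cvg_ex; exists r; apply: cvg_near_cst.
by exists N => // n /= Nn; rewrite ur.
Qed.

Lemma absQ2_pi : forall u : cauchySeq,
  (fun n => abs2 (u n) : rat^o) @ \oo --> (absQ2 (\pi_Q2 u) : rat^o).
Proof.
move=> u; rewrite /absQ2; set v := repr (\pi_Q2 u) : cauchySeq.
have uv : null2 (u - v : cauchySeq) by apply/eq_Q2; rewrite reprK.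
have vl : (fun n => abs2 (v n) : rat^o) @ \oo --> (absQ2 (\pi_Q2 u) : rat^o).
  exact: cauchy2_abs_cvg (cauchySeqP v).
apply/cvgrPdist_lt => e e0.
have e20 : 0 < e / 2%:R by rewrite divr_gt0.
have /cvgrPdist_lt /(_ _ e20)[N1 _ vN] := vl.
have [N2 uvN] := uv _ e20.
exists (maxn N1 N2) => // n; rewrite /= geq_max => /andP[n1 n2].
rewrite [e]splitr (le_lt_trans (ler_distD (abs2 (v n)) _ _))// ltrD ?vN//.
by apply: le_lt_trans (abs2_dist _ _) _; rewrite abs2B; exact: uvN.
Qed.

Arguments absQ2_pi : clear implicits.

Lemma absQ2_0 : absQ2 0 = 0.
Proof.
rewrite -Q2_pi0; apply: (rat_lim_uniq (absQ2_pi 0)).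
by apply: null2_cvg => e e0; exists 0%N => n _; rewrite abs2_0.
Qed.

Lemma absQ2_ge0 (x : Q2) : 0 <= absQ2 x.
Proof.
rewrite -[x]reprK; apply: cvgr_to_ge (absQ2_pi _) _.
by apply: nearW => n; exact: abs2_ge0.
Qed.

Lemma absQ2_eq0 (x : Q2) : absQ2 x = 0 -> x = 0.
Proof.
rewrite -[x]reprK; set u := repr x : cauchySeq => u0.
apply: contrapT => uN.
have /(cauchy2_stable (cauchySeqP u))[r r0 [N ur]] : ~ null2 u.
  by move=> un; apply: uN; rewrite -Q2_pi0; apply/eq_Q2; rewrite subr0.
have : absQ2 (\pi_Q2 u) = r.
  apply: (rat_lim_uniq (absQ2_pi u)); apply: cvg_near_cst.
  by exists N => // n /= Nn; rewrite ur.
by rewrite u0 => r0'; rewrite -r0' ltxx in r0.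
Qed.

Lemma absQ2N (x : Q2) : absQ2 (- x) = absQ2 x.
Proof.
rewrite -[x]reprK -Q2_piN; apply: (rat_lim_uniq (absQ2_pi _)).
under eq_fun do rewrite abs2N.
exact: absQ2_pi.
Qed.

Lemma absQ2D (x y : Q2) : absQ2 (x + y) <= absQ2 x + absQ2 y.
Proof.
rewrite -[x]reprK -[y]reprK -Q2_piD.
apply: ler_cvg_to (absQ2_pi _) (cvgD (absQ2_pi _) (absQ2_pi _)) _.
apply: nearW => n; apply: le_trans (abs2D _ _) _.
by rewrite ge_max lerDl lerDr !abs2_ge0.
Qed.

Local Lemma Q2_distxx (x : Q2) : absQ2 (x - x) = 0.
Proof. by rewrite subrr absQ2_0. Qed.

Local Lemma Q2_dist_eq0 (x y : Q2) : absQ2 (x - y) = 0 -> x = y.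
Proof. by move=> /absQ2_eq0 /subr0_eq. Qed.

Local Lemma Q2_distC (x y : Q2) : absQ2 (x - y) = absQ2 (y - x).
Proof. by rewrite -absQ2N opprB. Qed.

Local Lemma Q2_dist_triangle (y x z : Q2) :
  absQ2 (x - z) <= absQ2 (x - y) + absQ2 (y - z).
Proof. by rewrite -(subrK y x) -[_ - z]addrA (addrK y) absQ2D. Qed.

HB.instance Definition _ :=
  isMetric.Build rat Q2 Q2_distxx Q2_dist_eq0 Q2_distC Q2_dist_triangle.
HB.instance Definition _ := isPointed.Build Q2 0.

Definition Z2 : set Q2 := [set x | absQ2 x <= 1].

(** The usual topology of the projective line over the locally compact field
   [Q2] is the one-point compactification topology; [None] is the point at
   infinity. *)
Notation PQ2 := (one_point_compactification Q2).

Definition mobius (a b c d : Q2) (z : PQ2) : PQ2 :=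
  match z with
  | Some x => if c * x + d == 0 then None else Some ((a * x + b) / (c * x + d))
  | None => if c == 0 then None else Some (a / c)
  end.

(** z |-> 1/z *)
Definition PQ2_inv : PQ2 -> PQ2 := mobius 0 1 1 0.

(** x |-> eta x + beta, fixing the point at infinity *)
Definition PQ2_affine (eta beta : Q2) : PQ2 -> PQ2 :=
  omap (fun x => eta * x + beta).

Notation Q2_borel := (g_sigma_algebraType (@open Q2)).
Notation PQ2_borel := (g_sigma_algebraType (@open PQ2)).

Definition subsystem (phi : PQ2 -> PQ2) (B : set PQ2) : Prop :=
  [/\ B !=set0, compact B & phi @` B `<=` B].

Definition minimal_subsystem (phi : PQ2 -> PQ2) (B : set PQ2) : Prop :=
  subsystem phi B /\
  forall x, B x -> B = closure (range (fun n : nat => iter n phi x)).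

Section measures.
Context (R : realType).

(** Borel probability measures on [B] are represented by Borel probability
   measures on [PQ2] giving mass 1 to [B]. *)
Definition invariant_prob (phi : PQ2 -> PQ2) (B : set PQ2)
    (sigma : probability PQ2_borel R) : Prop :=
  sigma B = 1%E /\
  forall A : set PQ2_borel, measurable A -> A `<=` B ->
    sigma (B `&` phi @^-1` A) = sigma A.

(** Measures are compared on Borel sets only, since the value of a
   [probability] on other sets is not meaningful. *)
Definition unique_invariant_prob (phi : PQ2 -> PQ2) (B : set PQ2)
    (sigma : probability PQ2_borel R) : Prop :=
  invariant_prob phi B sigma /\
  forall tau : probability PQ2_borel R, invariant_prob phi B tau ->
    forall A : set PQ2_borel, measurable A -> A `<=` B -> tau A = sigma A.

(** The Haar probability measure on [Z2], seen as a Borel measure on [Q2]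
   giving mass 1 to [Z2]. *)
Definition haar_Z2 (mu0 : probability Q2_borel R) : Prop :=
  mu0 Z2 = 1%E /\
  forall (x : Q2) (A : set Q2_borel), Z2 x -> measurable A -> A `<=` Z2 ->
    mu0 [set x + y | y in A] = mu0 A.

Definition mubar (mu0 : probability Q2_borel R) (S : set PQ2) : \bar R :=
  let S1 := Some @` Z2 `&` S in
  let S2 := ~` (Some @` Z2) `&` S in
  ((2^-1)%:E * mu0 (Some @^-1` S1) + mu0 (Some @^-1` (PQ2_inv @^-1` S2)))%E.

(** [absL] is the absolute value of [L] extending the one of [Q2] (it is
   unique, since [Q2] is complete and [L] is finite over [Q2]). *)
Definition extends_absQ2 (L : fieldExtType Q2) (absL : L -> R) : Prop :=
  [/\ forall z, 0 <= absL z,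
      forall z, absL z = 0 -> z = 0,
      forall z w, absL (z * w) = absL z * absL w,
      forall z w, absL (z + w) <= absL z + absL w &
      forall x : Q2, absL x%:A = ratr (absQ2 x)].

(** The valuation v_2 = - log_2 |.|_2 attached to an absolute value. *)
Definition valuation2 (L : Type) (absL : L -> R) (z : L) : R :=
  - (ln (absL z) / ln 2).

End measures.

(* Main.v *)
(** Let Q be the form c X^2 + (d - a) X Y - b Y^2, which vanishes at the fixed
   points of phi. As Delta is not a square in Q_2, the function
     D(x, y) = |Delta| |det (x, y)|^2 / (|Q x| |Q y|)
   is defined on all of P^1(Q_2), and phi preserves it. In the coordinate
   z = h^-1 x, D is the squared distance of 2 z and 2 z' if both z and z' lie
   in Z_2, that of 1/z and 1/z' if neither does, and 1/2 otherwise. So all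
   D-balls of a given radius have the same mass for the image of mubar under h,
   and this image is invariant under phi.
   Let M be the matrix of phi and M^k = u_k M + w_k. Then
   D(phi^k x, x) = |Delta u_k^2 / det(M)^k| does not depend on x; it is nonzero
   since lambda is not a root of unity, and once it is less than 1/4 it is
   divided by 4 when k is doubled. As the residue field has two elements, every
   orbit closure therefore contains a ball, and B has positive mass.
   For uniqueness, an invariant probability gives the same mass to all balls of
   a given radius that meet B, because every orbit in B visits all of them. *)

Require Import Defs.
From mathcomp Require Import all_boot all_order all_algebra all_field.
From mathcomp Require Import generic_quotient.
From mathcomp Require Import all_classical all_reals all_analysis.
From mathcomp Require Import zify ring lra.

Set Implicit Arguments.
Unset Strict Implicit.
Unset Printing Implicit Defensive.

Import Order.TTheory GRing.Theory Num.Theory numFieldNormedType.Exports.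
Local Open Scope classical_set_scope.
Local Open Scope ring_scope.
Local Open Scope quotient_scope.

(** Completing the square gives [4 c Q(X, Y) = (2 c X - (a - d) Y) ^ 2 - Delta Y ^ 2]. Write
    [Delta = w ^ 2 j] with [w = 2 ^ v], where [v] is the valuation of sqrt Delta. At [(h z, 1)] the
    right side is [w ^ 2 ((2 eps z - 1) ^ 2 - j)], where [eps = c eta / w] is a unit. The condition
    on [i] enters as |1 - j| = 1/2: then |(2 eps z - 1) ^ 2 - j| is 1/2 on Z_2 and larger elsewhere.
    So [h] carries Z_2 onto the points of Q_2 nearest to the two conjugate fixed points, which
    accounts for the shift by [2 ^ v] in [h]. The weight 1/2 in [mubar] reflects the coordinates 2 z
    and 1/z: the D-ball of radius 4^-(n+1) has radius 2^-n in z on one side, but 2^-(n+1) in 1/z on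
    the other. The doubling argument needs a first k > 0 with D(phi^k x, x) at most 1/16. Pigeonhole
    supplies it: there are finitely many D-balls of that radius, and phi is an isometry, so some
    iterate brings x back into its own ball. *)

(** * Absolute value and value group of Q_2 *)

Lemma absQ2M (x y : Q2) : absQ2 (x * y) = absQ2 x * absQ2 y.
Proof.
rewrite -[x]reprK -[y]reprK -Q2_piM.
apply: (cvg_unique (@norm_hausdorff rat rat^o) (absQ2_pi (repr x * repr y))).
rewrite [X in X @ _](_ : _ =
    (fun n => abs2 (cseq (repr x) n) * abs2 (cseq (repr y) n) : rat^o)); last first.
  by apply/funext => n; rewrite -abs2M.
exact: (cvgM (absQ2_pi _) (absQ2_pi _)).
Qed.

Lemma cst_cauchy (q : rat) : (fun _ : nat => q) \in cauchy2_pred.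
Proof. by apply/asboolP => e e0; exists 0%N => m n _ _; rewrite subrr abs2_0. Qed.

Definition rat_Q2 (q : rat) : Q2 := \pi_Q2 (CauchySeq (cst_cauchy q)).

Lemma absQ2_rat (q : rat) : absQ2 (rat_Q2 q) = abs2 q.
Proof.
apply: (cvg_unique (@norm_hausdorff rat rat^o) (absQ2_pi _)).
by apply: cvg_near_cst; exists 0%N => // n _.
Qed.

Lemma absQ2_dense_near (u : cauchySeq) (e : rat) : 0 < e ->
  exists N, forall n, (N <= n)%N -> absQ2 (\pi_Q2 u - rat_Q2 (u n)) <= e.
Proof.
move=> e0; have [N uN] := cauchySeqP u e0; exists N => n Nn.
rewrite -Q2_piN -Q2_piD.
apply: cvgr_to_le (absQ2_pi _) _; exists N => // m /= Nm.
by apply/ltW/uN.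
Qed.

Lemma absQ2_dense (x : Q2) (e : rat) : 0 < e -> exists q, absQ2 (x - rat_Q2 q) <= e.
Proof.
move=> e0; have [N /(_ N (leqnn N)) uN] := absQ2_dense_near (repr x) e0.
by exists (repr x N); rewrite -{1}[x]reprK.
Qed.

Lemma absQ2_gt0 (x : Q2) : (0 < absQ2 x) = (x != 0).
Proof.
rewrite lt_neqAle absQ2_ge0 andbT eq_sym; congr (~~ _).
by apply/eqP/eqP => [/absQ2_eq0//|->]; rewrite absQ2_0.
Qed.

Lemma absQ2_stable (x : Q2) (q : rat) :
  absQ2 (x - rat_Q2 q) < absQ2 x -> absQ2 x = abs2 q.
Proof.
rewrite -[x]reprK; set u := repr x : cauchySeq => xq.
apply: (cvg_unique (@norm_hausdorff rat rat^o) (absQ2_pi u)).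
have := absQ2_pi (u - CauchySeq (cst_cauchy q)).
rewrite Q2_piD Q2_piN -/(rat_Q2 q) => c1.
apply: cvg_near_cst.
(* [|u n| - |u n - q|] has a positive limit. Wherever it is positive, the ultrametric inequality
   forces [|u n| = |q|], so [|u n|] is eventually constant. *)
have c2 := cvgB (absQ2_pi u) c1.
have c3 := @cvgr_gt rat nat \oo _ _ _ (c2 _) 0.
apply: filterS (c3 _ _ _) => [n|]; last by rewrite subr_gt0.
by rewrite subr_gt0 => un; apply/esym/abs2_isosceles; rewrite abs2B.
Qed.

Lemma absQ2_approx (x : Q2) : x != 0 -> exists q, absQ2 (x - rat_Q2 q) < absQ2 x.
Proof.
rewrite -absQ2_gt0 => x0; have [q xq] := absQ2_dense x (divr_gt0 x0 (ltr0n _ 2)).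
by exists q; apply: le_lt_trans xq _; rewrite ltr_pdivrMr // ltr_pMr // ltr1n.
Qed.

Lemma absQ2_exp2 (x : Q2) : x != 0 -> exists m : int, absQ2 x = 2%:R ^ m.
Proof.
move=> x0; have [q /absQ2_stable xq] := absQ2_approx x0.
have q0 : q != 0 by rewrite -abs2_eq0 -xq gt_eqF // absQ2_gt0.
by exists (- val2 q); rewrite xq /abs2 (negbTE q0).
Qed.

Lemma rat_Q2D (p q : rat) : rat_Q2 (p + q) = rat_Q2 p + rat_Q2 q.
Proof. by rewrite -Q2_piD; congr (\pi_Q2 _); apply: val_inj. Qed.

Lemma rat_Q2_nat (n : nat) : rat_Q2 n%:R = n%:R.
Proof.
elim: n => [|n IH]; first by rewrite !mulr0n -Q2_pi0; congr (\pi_Q2 _); apply: val_inj.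
rewrite -addn1 !natrD rat_Q2D IH; congr (_ + _).
by rewrite -Q2_pi1; congr (\pi_Q2 _); apply: val_inj.
Qed.

Lemma absQ2_nat (n : nat) : absQ2 n%:R = abs2 n%:R.
Proof. by rewrite -rat_Q2_nat absQ2_rat. Qed.

Lemma absQ2_2 : absQ2 2%:R = 2%:R^-1.
Proof.
rewrite absQ2_nat -[2%:R]/((2%N%:Z)%:~R) abs2_intE //.
Qed.

Lemma absQ2_le_max (x y : Q2) : absQ2 (x + y) <= Num.max (absQ2 x) (absQ2 y).
Proof.
apply/ler_addgt0Pr => e e0.
rewrite -[x]reprK -[y]reprK -Q2_piD; set u := repr x; set v := repr y.
apply: cvgr_to_le (absQ2_pi (u + v)) _.
have H w : \forall n \near \oo, abs2 (cseq w n) < absQ2 (\pi_Q2 w) + e.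
  by apply: (cvgr_lt _ (absQ2_pi w)); rewrite ltrDl.
near=> n; apply: le_trans (abs2D _ _) _.
rewrite ge_max; apply/andP; split.
  apply: ltW; apply: lt_le_trans (_ : absQ2 (\pi_Q2 u) + e <= _); first by near: n;
    exact: H.
  by rewrite lerD2r le_max lexx.
apply: ltW; apply: lt_le_trans (_ : absQ2 (\pi_Q2 v) + e <= _); first by near: n; exact:
  H.
by rewrite lerD2r le_max lexx orbT.
Unshelve. all: by end_near. Qed.

(** The value group is 2^Z with uniformizer 2, and the last clause says that the residue field has
    two elements. The chart geometry is done over any such field and then applied to [absQ2]. *)
Definition dyadic_abs (F : fieldType) (N : F -> rat) : Prop :=
  [/\ forall x, (N x == 0) = (x == 0),
      forall x y, N (x * y) = N x * N y,
      forall x y, N (x + y) <= Num.max (N x) (N y),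
      N 2%:R = 2%:R^-1 &
      (forall x, x != 0 -> exists m : int, N x = 2%:R ^ m) /\
      (forall x, N x <= 1 -> N x <= 2%:R^-1 \/ N (x - 1) <= 2%:R^-1)].

Section dyadic_abs_theory.
Variables (F : fieldType) (N : F -> rat) (hN : dyadic_abs N).
Implicit Types x y z : F.

Lemma dabs_eq0 x : (N x == 0) = (x == 0). Proof. by case: hN. Qed.
Lemma dabsM x y : N (x * y) = N x * N y. Proof. by case: hN. Qed.
Lemma dabsD x y : N (x + y) <= Num.max (N x) (N y). Proof. by case: hN. Qed.
Lemma dabs2 : N 2%:R = 2%:R^-1. Proof. by case: hN. Qed.
Lemma dabs_exp2 x : x != 0 -> exists m : int, N x = 2%:R ^ m.
Proof. by case: hN => _ _ _ _ [H _]; exact: H. Qed.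
Lemma dabs_residue x : N x <= 1 -> N x <= 2%:R^-1 \/ N (x - 1) <= 2%:R^-1.
Proof. by case: hN => _ _ _ _ [_ H]; exact: H. Qed.

Lemma dabs0 : N 0 = 0. Proof. by apply/eqP; rewrite dabs_eq0. Qed.

Lemma dabs_ge0 x : 0 <= N x.
Proof.
have [->|/dabs_exp2[m ->]] := eqVneq x 0; first by rewrite dabs0.
by rewrite exprz_ge0.
Qed.

Lemma dabs_gt0 x : (0 < N x) = (x != 0).
Proof. by rewrite lt_def dabs_ge0 andbT dabs_eq0. Qed.

Lemma dabs1 : N 1 = 1.
Proof.
have n1 : N 1 != 0 by rewrite dabs_eq0 oner_eq0.
by apply: (mulfI n1); rewrite -dabsM !mulr1.
Qed.

Lemma dabsN x : N (- x) = N x.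
Proof.
suff H : N (-1) = 1 by rewrite -mulN1r dabsM H mul1r.
have /eqP : N (-1) ^+ 2 = 1 by rewrite expr2 -dabsM mulrNN mulr1 dabs1.
rewrite sqrf_eq1 => /orP[/eqP//|/eqP H].
by have := dabs_ge0 (-1); rewrite H; lra.
Qed.

Lemma dabsB x y : N (x - y) = N (y - x).
Proof. by rewrite -dabsN opprB. Qed.

Lemma dabsX x n : N (x ^+ n) = N x ^+ n.
Proof. by elim: n => [|n IH]; rewrite ?expr0 ?dabs1 // !exprS dabsM IH. Qed.

Lemma dabsV x : N x^-1 = (N x)^-1.
Proof.
have [->|x0] := eqVneq x 0; first by rewrite invr0 dabs0 invr0.
have n0 : N x != 0 by rewrite dabs_eq0.
by apply: (mulfI n0); rewrite -dabsM !divff // dabs1.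
Qed.

Lemma dabs_le x y r : N x <= r -> N y <= r -> N (x + y) <= r.
Proof. by move=> hx hy; apply: le_trans (dabsD _ _) _; rewrite ge_max hx. Qed.

Lemma dabs_leB x y r : N x <= r -> N y <= r -> N (x - y) <= r.
Proof. by move=> hx hy; apply: dabs_le => //; rewrite dabsN. Qed.

Lemma dabs_dom x y : N y < N x -> N (x + y) = N x.
Proof.
move=> yx; apply/eqP; rewrite eq_le dabs_le ?(ltW yx) //= leNgt.
apply/negP => h; have := dabsD (x + y) (- y).
by rewrite addrK dabsN le_max leNgt h leNgt yx.
Qed.

(** The unit [x / y] is congruent to 1 modulo 2, because 1 is the only nonzero residue. *)
Lemma dabs_eq_half x y : N x = N y -> N (x - y) <= N x / 2%:R.
Proof.
have [->|y0] := eqVneq y 0; first by rewrite dabs0 subr0 => ->; lra.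
move=> xy; have yN : N y != 0 by rewrite dabs_eq0.
have -> : x - y = (x / y - 1) * y by rewrite mulrBl mul1r divfK.
have xy1 : N (x / y) = 1 by rewrite dabsM dabsV xy divff.
rewrite dabsM xy mulrC ler_wpM2l ?dabs_ge0 //.
case: (@dabs_residue (x / y)) => //; first by rewrite xy1.
by rewrite xy1; lra.
Qed.

Lemma dabs_gt1 x : 1 < N x -> 2%:R <= N x.
Proof.
have [->|/dabs_exp2[m ->]] := eqVneq x 0; first by rewrite dabs0; lra.
have e1 : (1 : rat) < 2%:R by [].
rewrite -{1}(expr0z (2%:R : rat)) ltr_eXz2l // => m1.
by rewrite -[leLHS]expr1z ler_eXz2l //; lia.
Qed.

Lemma dabs_lt_half x n :
  N x < 2%:R^-1 ^+ n -> N x <= 2%:R^-1 ^+ n.+1.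
Proof.
have [->|/dabs_exp2[m ->]] := eqVneq x 0; first by rewrite dabs0 exprn_ge0 // invr_ge0.
have e1 : (1 : rat) < 2%:R by [].
rewrite !exprVn !exprnN ltr_eXz2l // ler_eXz2l //; lia.
Qed.

Lemma dabs_le1_exp x n : x != 0 -> N x <= 2%:R^-1 ^+ n ->
  exists2 m, (n <= m)%N & N x = 2%:R^-1 ^+ m.
Proof.
have e1 : (1 : rat) < 2%:R by [].
move=> /dabs_exp2[m ->]; rewrite !exprVn !exprnN ler_eXz2l // => mn.
exists `|m|%N; first by lia.
by rewrite exprVn exprnN; congr (_ ^ _); lia.
Qed.

Lemma dabs_two_expz (m : int) : N (2%:R ^ m) = 2%:R ^ (- m).
Proof.
case: m => n; first by rewrite -exprnP dabsX dabs2 -exprnN exprVn.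
by rewrite NegzE opprK -exprnN dabsV dabsX dabs2 exprVn invrK.
Qed.

End dyadic_abs_theory.

(** * Homogeneous coordinates and powers of the matrix of phi *)

Section mobius_geometry.
Variable F : fieldType.

(** For [F = Q2] this is convertible to [mobius], which carries the algebra below over to [PQ2]. *)
Definition mob (a b c d : F) (p : option F) : option F :=
  match p with
  | Some x => if c * x + d == 0 then None else Some ((a * x + b) / (c * x + d))
  | None => if c == 0 then None else Some (a / c)
  end.

(** The point [[X : Y]]. The pair [(0, 0)] also goes to [None], hence the side conditions
    [(X != 0) || (Y != 0)] below. *)
Definition proj_pt (X Y : F) : option F := if Y == 0 then None else Some (X / Y).

Lemma mob_pt a b c d X Y : a * d - b * c != 0 -> (X != 0) || (Y != 0) ->
  mob a b c d (proj_pt X Y) = proj_pt (a * X + b * Y) (c * X + d * Y).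
Proof.
move=> det; rewrite /proj_pt; have [->|Y0] := eqVneq Y 0.
  rewrite orbF /= !mulr0 !addr0 => X0; rewrite mulf_eq0 (negbTE X0) orbF.
  have [//|c0] := eqVneq c 0; congr Some; by field; rewrite c0 X0.
move=> _; rewrite /=.
have -> : (c * (X / Y) + d == 0) = (c * X + d * Y == 0).
  have -> : c * (X / Y) + d = (c * X + d * Y) / Y by field.
  by rewrite mulf_eq0 invr_eq0 (negbTE Y0) orbF.
case: eqP => // /eqP h; congr Some; field; rewrite Y0 /=.
by rewrite h.
Qed.

Lemma proj_pt_scale X Y X' Y' : (X != 0) || (Y != 0) -> (X' != 0) || (Y' != 0) ->
  proj_pt X Y = proj_pt X' Y' ->
  exists2 k, k != 0 & X = k * X' /\ Y = k * Y'.
Proof.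
rewrite /proj_pt; have [->|Y0] := eqVneq Y 0; have [->|Y'0] := eqVneq Y' 0 => //.
  rewrite !orbF => X0 X'0 _; exists (X / X'); last by rewrite mulr0 divfK.
  by rewrite mulf_neq0 // invr_eq0.
move=> _ _ [XY]; exists (Y / Y'); first by rewrite mulf_neq0 // invr_eq0.
by rewrite divfK //; split => //; rewrite mulrAC -mulrA -XY mulrCA divff ?mulr1.
Qed.

End mobius_geometry.

Section mobius_power.
Variables (F : fieldType) (a b c d : F).
Local Notation tau := (a + d).
Local Notation delta := (a * d - b * c).
Local Notation Delta := ((d - a) ^+ 2 + 4%:R * b * c).

(* [mob_pow k = (u, w)] with [M ^ k = u M + w] for [M = (a b; c d)], by
   Cayley-Hamilton. *)
Fixpoint mob_pow (k : nat) : F * F :=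
  if k is k'.+1 then
    let uw := mob_pow k' in (uw.1 * tau + uw.2, - (uw.1 * delta))
  else (0, 1).

(** Expand [(u M + w) (u' M + w')] and replace [M ^ 2] by [tau M - delta]. *)
Lemma mob_powD m n :
  mob_pow (m + n) =
  let: (u, w) := mob_pow m in let: (u', w') := mob_pow n in
  (u * u' * tau + u * w' + w * u', w * w' - delta * u * u').
Proof.
elim: m => [|m IH].
  by rewrite add0n /=; case: (mob_pow n) => u w; congr (_, _); ring.
rewrite addSn /= IH; case: (mob_pow m) (mob_pow n) => [u w] [u' w'] /=.
by congr (_, _); ring.
Qed.

(** The left side is the squared trace of [M ^ k = u M + w], whose determinant is [delta ^ k] and
    whose discriminant is [Delta u ^ 2]. *)
Lemma mob_pow_norm k : let: (u, w) := mob_pow k in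
  (u * tau + 2%:R * w) ^+ 2 = Delta * u ^+ 2 + 4%:R * delta ^+ k.
Proof.
suff : let: (u, w) := mob_pow k in w ^+ 2 + u * w * tau + delta * u ^+ 2 = delta ^+ k.
  by case: (mob_pow k) => u w IH; rewrite -IH; ring.
elim: k => [|k] /=; first by rewrite !expr2; ring.
case: (mob_pow k) => u w /= IH; rewrite (exprS delta) -IH; ring.
Qed.

(** This is the determinant of the vectors [x = (X, Y)] and [M x]. Applying [M] to both therefore
    multiplies it by [delta], and it vanishes exactly on eigenvectors and 0. *)
Definition mob_form (X Y : F) := c * X ^+ 2 + (d - a) * (X * Y) - b * Y ^+ 2.

Lemma mob_form_image X Y :
  mob_form (a * X + b * Y) (c * X + d * Y) = delta * mob_form X Y.
Proof. by rewrite /mob_form; ring. Qed.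

Lemma mob_form0 X Y : mob_form X Y != 0 -> (X != 0) || (Y != 0).
Proof.
apply: contraNT; rewrite negb_or !negbK => /andP[/eqP-> /eqP->].
by apply/eqP; rewrite /mob_form; ring.
Qed.

Definition mob_pow_pt k (X Y : F) :=
  let: (u, w) := mob_pow k in
  (u * (a * X + b * Y) + w * X, u * (c * X + d * Y) + w * Y).

Lemma mob_pow_ptS k X Y :
  mob_pow_pt k.+1 X Y =
  let: (X', Y') := mob_pow_pt k X Y in (a * X' + b * Y', c * X' + d * Y').
Proof.
by rewrite /mob_pow_pt /=; case: (mob_pow k) => u w /=; congr (_, _); ring.
Qed.

Lemma iter_mob_pt k X Y : delta != 0 -> mob_form X Y != 0 ->
  let: (X', Y') := mob_pow_pt k X Y in
  mob_form X' Y' = delta ^+ k * mob_form X Y /\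
  iter k (mob a b c d) (proj_pt X Y) = proj_pt X' Y'.
Proof.
move=> dn Q0; elim: k => [|k].
  by rewrite /mob_pow_pt /= !mul0r !add0r !mul1r.
rewrite mob_pow_ptS; case: (mob_pow_pt k X Y) => X' Y' [QE iE].
rewrite mob_form_image QE (exprS delta) mulrA iterS iE mob_pt //.
by apply: mob_form0; rewrite QE mulf_neq0 // expf_neq0.
Qed.

End mobius_power.

(** * The chart and the phi-invariant distance *)

Section chart.
Variables (F : fieldType) (N : F -> rat) (hN : dyadic_abs N).
Variables (a b c d w eps j beta eta : F).
Local Notation delta := (a * d - b * c).
Local Notation Delta := ((d - a) ^+ 2 + 4%:R * b * c).
Hypotheses (det0 : delta != 0) (c0 : c != 0) (w0 : w != 0)
  (Neps : N eps = 1) (Nj : N (1 - j) = 2%:R^-1)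
  (DeltaE : Delta = w ^+ 2 * j) (etaE : c * eta = w * eps)
  (betaE : 2%:R * c * beta = a - d - w).
Local Notation phi := (mob a b c d).
Local Notation Q := (mob_form a b c d).

(* The point [p = h z] of side [true] (resp. [false]) has [z] in [Z_2] (resp.
   not in [Z_2]), and chart coordinate [2 z] (resp. [1 / z], with [1 / oo = 0]),
   which lies in [2 Z_2] in both cases. *)
Definition side (p : option F) : bool :=
  if p is Some x then N ((x - beta) / eta) <= 1 else false.

Definition coord (p : option F) : F :=
  if p is Some x then
    let z := (x - beta) / eta in if N z <= 1 then 2%:R * z else z^-1
  else 0.

(** Homogeneous coordinates [[eta z + beta : 1]] on one side and [[eta + beta y : y]] with
    [y = 1 / z] on the other, scaled so that the absolute value of the form depends on the side
    only. *)
Definition chartX (p : option F) :=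
  if side p then eta * (coord p / 2%:R) + beta else eta + beta * coord p.
Definition chartY (p : option F) := if side p then 1 else coord p.

Let two0 : (2%:R : F) != 0.
Proof. by rewrite -(dabs_eq0 hN) dabs2. Qed.

Let eta0 : eta != 0.
Proof.
have : c * eta != 0 by rewrite etaE mulf_neq0 // -(dabs_eq0 hN) Neps.
by apply: contraNneq => ->; rewrite mulr0.
Qed.

Lemma coord_le p : N (coord p) <= 2%:R^-1.
Proof.
case: p => [x|] /=; last by rewrite (dabs0 hN).
set z := (x - beta) / eta; case: ifP => [z1|/negbT].
  by rewrite (dabsM hN) (dabs2 hN); lra.
rewrite -ltNge => /(dabs_gt1 hN) z2.
by rewrite (dabsV hN) lef_pV2 // posrE (lt_le_trans _ z2).
Qed.

Lemma chart_pt p : proj_pt (chartX p) (chartY p) = p.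
Proof.
rewrite /chartX /chartY; case: p => [x|] /=; last by rewrite /proj_pt eqxx.
set z := (x - beta) / eta.
have xE : x = eta * z + beta by rewrite /z mulrC divfK // subrK.
case: (boolP (N z <= 1)) => [z1|].
  by rewrite /proj_pt oner_eq0 divr1 [2%:R * z]mulrC mulfK ?xE.
rewrite -ltNge => zN; have z0 : z != 0 by rewrite -(dabs_gt0 hN) (lt_trans _ zN).
by rewrite /proj_pt invr_eq0 (negbTE z0) invrK xE mulrDl divfK.
Qed.

Let K := w ^+ 2 / (4%:R * c).

Let four0 : (4%:R : F) != 0.
Proof. by rewrite -[4%N]/(2 * 2)%N natrM mulf_neq0. Qed.

(** At this point [2 c X - (a - d) Y] equals [w (2 eps z - v)]; the rest is the completed square. *)
Let QchartE z v :
  Q (eta * z + beta * v) v = K * ((2%:R * eps * z - v) ^+ 2 - j * v ^+ 2).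
Proof.
have etaE' : eta = w * eps / c by rewrite -etaE mulrC mulrA mulVf ?mul1r.
have betaE' : beta = (a - d - w) / (2%:R * c).
  by rewrite -betaE mulrC mulrA mulVf ?mul1r // mulf_neq0.
have jE : j = Delta / w ^+ 2 by rewrite DeltaE mulrC mulrA mulVf ?mul1r // expf_neq0.
rewrite /K /mob_form etaE' betaE' jE; field.
by rewrite c0 w0 /= ?four0 ?two0.
Qed.

Let N4 : N 4%:R = 4%:R^-1.
Proof. by rewrite -[4%N]/(2 * 2)%N natrM (dabsM hN) (dabs2 hN). Qed.

(** On the side of Z_2 the term [1 - j] of size 1/2 dominates, the others having size at most 1/4.
    On the other side [4 eps ^ 2] of size 1/4 dominates, the others having size at most 1/8. *)
Lemma dabs_chart_form p :
  N (Q (chartX p) (chartY p)) = N K * (if side p then 2%:R^-1 else 4%:R^-1).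
Proof.
have := coord_le p; rewrite /chartX /chartY; set y := coord p => yh.
have yy : N y ^+ 2 <= 4%:R^-1.
  have -> : (4%:R^-1 : rat) = 2%:R^-1 ^+ 2 by [].
  by rewrite ler_sqr // ?nnegrE ?(dabs_ge0 hN) // invr_ge0.
case: (side p).
  have {1}-> : beta = beta * 1 by rewrite mulr1.
  rewrite QchartE (dabsM hN); congr (_ * _).
  have -> : (2%:R * eps * (y / 2%:R) - 1) ^+ 2 - j * 1 ^+ 2 =
     (1 - j) + ((eps * y) ^+ 2 - 2%:R * (eps * y)) by field.
  rewrite (dabs_dom hN) Nj //.
  apply: le_lt_trans (_ : 4%:R^-1 < _); last by lra.
  apply: (dabs_leB hN); first by rewrite (dabsX hN) (dabsM hN) Neps mul1r.
  by rewrite !(dabsM hN) Neps (dabs2 hN); lra.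
have {1}-> : eta = eta * 1 by rewrite mulr1.
rewrite QchartE (dabsM hN); congr (_ * _).
have -> : (2%:R * eps * 1 - y) ^+ 2 - j * y ^+ 2 =
   (4%:R * eps ^+ 2) + ((1 - j) * y ^+ 2 - 4%:R * (eps * y)) by ring.
have E : N (4%:R * eps ^+ 2) = 4%:R^-1 by rewrite (dabsM hN) (dabsX hN) Neps N4.
rewrite (dabs_dom hN) E //.
apply: le_lt_trans (_ : 8%:R^-1 < _); last by lra.
apply: (dabs_leB hN); rewrite (dabsM hN).
  by rewrite Nj (dabsX hN); lra.
by rewrite N4 (dabsM hN) Neps; lra.
Qed.

Let K0 : N K != 0.
Proof. by rewrite (dabs_eq0 hN) mulf_neq0 ?expf_neq0 // invr_eq0 mulf_neq0. Qed.

Lemma chart_form_neq0 p : Q (chartX p) (chartY p) != 0.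
Proof.
by rewrite -(dabs_eq0 hN) dabs_chart_form mulf_neq0 //; case: ifP; rewrite invr_eq0.
Qed.

(* This is |Delta| |det (x, y)|^2 / (|Q x| |Q y|), see [cross_dist_pt]. *)
Definition cross_dist (p q : option F) : rat :=
  if side p == side q then N (coord p - coord q) ^+ 2 else 2%:R^-1.

Let Nj1 : N j = 1.
Proof.
have -> : j = 1 - (1 - j) by ring.
by rewrite (dabs_dom hN) ?(dabs1 hN) // (dabsN hN) Nj; lra.
Qed.

(** On one side the determinant is [eta] times the difference of the coordinates, up to sign and a
    factor 2; across sides it is [eta] times a unit. By [KE], the value across sides is (1/16) /
    (1/2 * 1/4) = 1/2, which is the constant in [cross_dist]. *)
Let chart_cross p q :
  cross_dist p q * (N (Q (chartX p) (chartY p)) * N (Q (chartX q) (chartY q))) =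
  N Delta * N (chartX p * chartY q - chartX q * chartY p) ^+ 2.
Proof.
have KE : N Delta * N eta ^+ 2 = N K ^+ 2 / 16%:R.
  have : c ^+ 2 * (eta ^+ 2) = w ^+ 2 * eps ^+ 2 by rewrite -!exprMn etaE.
  move=> /(congr1 N); rewrite (dabsM hN (c ^+ 2)) (dabsM hN (w ^+ 2)).
  rewrite !(dabsX hN) Neps expr1n mulr1.
  rewrite DeltaE /K (dabsM hN (w ^+ 2)) (dabsM hN (w ^+ 2)) (dabsV hN).
  rewrite (dabsM hN 4%:R) !(dabsX hN).
  rewrite Nj1 mulr1 N4.
  have : N c != 0 by rewrite (dabs_eq0 hN).
  set C := N c => C0 E; have -> : N eta ^+ 2 = N w ^+ 2 / C ^+ 2.
    by rewrite -E mulrAC divff ?mul1r // expf_neq0.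
  by field.
have := coord_le p; have := coord_le q.
rewrite !dabs_chart_form /chartX /chartY /cross_dist.
have N2V : N 2%:R^-1 = 2%:R by rewrite (dabsV hN) (dabs2 hN) invrK.
set y := coord p; set y' := coord q => y'h yh.
case: (side p) (side q) => [] [] /=.
- have -> : (eta * (y / 2%:R) + beta) * 1 - (eta * (y' / 2%:R) + beta) * 1 =
    eta * ((y - y') / 2%:R) by field.
  rewrite (dabsM hN eta) (dabsM hN (y - y')) N2V !exprMn [RHS]mulrA KE; by field.
- have -> : (eta * (y / 2%:R) + beta) * y' - (eta + beta * y') * 1 =
    - (eta * (1 - y / 2%:R * y')) by ring.
  rewrite (dabsN hN) (dabsM hN eta) (dabs_dom hN (x := 1)); last first.
    rewrite (dabs1 hN) (dabsN hN) !(dabsM hN) N2V.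
    have := dabs_ge0 hN y; have := dabs_ge0 hN y'; nra.
  rewrite exprMn [RHS]mulrA KE (dabs1 hN); by field.
- have -> : (eta + beta * y) * 1 - (eta * (y' / 2%:R) + beta) * y =
    eta * (1 - y' / 2%:R * y) by ring.
  rewrite (dabsM hN eta) (dabs_dom hN (x := 1)); last first.
    rewrite (dabs1 hN) (dabsN hN) !(dabsM hN) N2V.
    have := dabs_ge0 hN y; have := dabs_ge0 hN y'; nra.
  rewrite exprMn [RHS]mulrA KE (dabs1 hN); by field.
- have -> : (eta + beta * y) * y' - (eta + beta * y') * y =
    - (eta * (y - y')) by ring.
  rewrite (dabsN hN) (dabsM hN eta) exprMn [RHS]mulrA KE; by field.
Qed.

(** Scaling the two vectors by [k] and [l] multiplies both sides by [|k l| ^ 2], so the chart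
    representatives suffice. *)
Lemma cross_dist_pt X Y X' Y' : Q X Y != 0 -> Q X' Y' != 0 ->
  cross_dist (proj_pt X Y) (proj_pt X' Y') * (N (Q X Y) * N (Q X' Y')) =
  N Delta * N (X * Y' - X' * Y) ^+ 2.
Proof.
move=> Q1 Q2; set p := proj_pt X Y; set q := proj_pt X' Y'.
have [k k0 [XE YE]] := proj_pt_scale (mob_form0 Q1)
  (mob_form0 (chart_form_neq0 p)) (esym (chart_pt _)).
have [l l0 [XE' YE']] := proj_pt_scale (mob_form0 Q2)
  (mob_form0 (chart_form_neq0 q)) (esym (chart_pt _)).
have QZ m U V : Q (m * U) (m * V) = m ^+ 2 * Q U V by rewrite /mob_form; ring.
have := chart_cross p q; rewrite XE YE XE' YE' !QZ.
move: (chartX p) (chartY p) (chartX q) (chartY q) => U V U' V' E.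
have -> : k * U * (l * V') - l * U' * (k * V) = k * l * (U * V' - U' * V) by ring.
rewrite !(dabsM hN (_ ^+ 2)) (dabsM hN (k * l)) (dabsM hN k l) !(dabsX hN).
transitivity (cross_dist p q * (N (Q U V) * N (Q U' V')) * (N k ^+ 2 * N l ^+ 2)).
  by ring.
by rewrite E; ring.
Qed.

(** [M] multiplies the determinant and both form values by [delta], and [|delta| ^ 2] cancels. *)
Lemma cross_dist_mob p q : cross_dist (phi p) (phi q) = cross_dist p q.
Proof.
have Q1 := chart_form_neq0 p; have Q2 := chart_form_neq0 q.
have Q1' := mob_form0 Q1; have Q2' := mob_form0 Q2.
rewrite -{1}(chart_pt p) -{1}(chart_pt q) !mob_pt //.
have := cross_dist_pt Q1 Q2; rewrite !chart_pt.
set X := chartX p in Q1 Q1' *; set Y := chartY p in Q1 Q1' *.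
set X' := chartX q in Q2 Q2' *; set Y' := chartY q in Q2 Q2' *.
have n1 : Q (a * X + b * Y) (c * X + d * Y) != 0 by rewrite mob_form_image mulf_neq0.
have n2 : Q (a * X' + b * Y') (c * X' + d * Y') != 0 by rewrite mob_form_image mulf_neq0.
have := cross_dist_pt n1 n2; rewrite !mob_form_image.
have -> : (a * X + b * Y) * (c * X' + d * Y') - (a * X' + b * Y') * (c * X + d * Y) =
   delta * (X * Y' - X' * Y) by ring.
rewrite !(dabsM hN delta) => E1 E2.
have dN : N delta != 0 by rewrite (dabs_eq0 hN).
have QN : N (Q X Y) * N (Q X' Y') != 0 by rewrite mulf_neq0 // (dabs_eq0 hN).
apply: (mulIf QN); rewrite E2; apply: (mulfI (expf_neq0 2 dN)).
transitivity (N Delta * (N delta * N (X * Y' - X' * Y)) ^+ 2); last by ring.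
by rewrite -E1; ring.
Qed.

(** The determinant of [M ^ k x] and [x] is [- u Q(x)], and [Q(M ^ k x) = delta ^ k Q(x)]. So [Q(x)]
    cancels and the displacement is the same for all points. *)
Lemma cross_dist_iter k p :
  cross_dist (iter k phi p) p * N delta ^+ k = N Delta * N (mob_pow a b c d k).1 ^+ 2.
Proof.
have Q1 := chart_form_neq0 p; rewrite -{1 2}(chart_pt p).
have := iter_mob_pt k det0 Q1; rewrite /mob_pow_pt.
set X := chartX p in Q1 *; set Y := chartY p in Q1 *.
case: (mob_pow a b c d k) => u v /= [QE ->].
have n1 : Q (u * (a * X + b * Y) + v * X) (u * (c * X + d * Y) + v * Y) != 0.
  by rewrite QE mulf_neq0 // expf_neq0.
have := cross_dist_pt n1 Q1; rewrite QE (dabsM hN (delta ^+ k)) (dabsX hN).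
have -> : (u * (a * X + b * Y) + v * X) * Y - X * (u * (c * X + d * Y) + v * Y) =
  - (u * Q X Y) by rewrite /mob_form; ring.
rewrite (dabsN hN) (dabsM hN u) => E.
have QN : N (Q X Y) != 0 by rewrite (dabs_eq0 hN).
apply: (mulIf (expf_neq0 2 QN)).
transitivity (N Delta * (N u * N (Q X Y)) ^+ 2); last by ring.
by rewrite -E; ring.
Qed.

(** By [mob_powD], u_2k is u_k times the trace of [M ^ k]. In [mob_pow_norm] the bound 1/16 < |4| =
    1/4 makes [4 delta ^ k] dominate [Delta u ^ 2], so the squared trace has size
    [|delta| ^ k / 4]. *)
Lemma cross_dist_double k p : (cross_dist (iter k phi p) p <= 16%:R^-1) ->
  cross_dist (iter (k + k) phi p) p = cross_dist (iter k phi p) p / 4%:R.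
Proof.
have := cross_dist_iter (k + k) p; have := cross_dist_iter k p.
have dN : N delta ^+ k != 0 by rewrite expf_neq0 // (dabs_eq0 hN).
rewrite mob_powD; have := mob_pow_norm a b c d k.
case: (mob_pow a b c d k) => u v /= nE E1 E2 D16.
have Nn : N (u * (a + d) + 2%:R * v) ^+ 2 = N delta ^+ k / 4%:R.
  rewrite -(dabsX hN) nE addrC (dabs_dom hN);
    first by rewrite (dabsM hN 4%:R) N4 (dabsX hN) mulrC.
  rewrite (dabsM hN 4%:R) (dabsM hN Delta) N4 !(dabsX hN) -E1.
  have : 0 < N delta ^+ k by rewrite exprn_gt0 // (dabs_gt0 hN).
  by move=> h; rewrite ltr_pM2r //; apply: le_lt_trans D16 _.
apply: (mulIf (expf_neq0 2 dN)); rewrite -exprM mulnC exprM.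
move: E2; rewrite exprD => E2.
have -> : (N delta ^+ 2) ^+ k = N delta ^+ k * N delta ^+ k by rewrite -exprM mulnC exprM expr2.
rewrite E2.
have -> : u * u * (a + d) + u * v + v * u = u * (u * (a + d) + 2%:R * v) by ring.
rewrite (dabsM hN u) exprMn Nn.
transitivity (N Delta * N u ^+ 2 * (N delta ^+ k / 4%:R)); first by ring.
by rewrite -E1; ring.
Qed.

Definition chart_ball n (p q : option F) : bool :=
  (side p == side q) && (N (coord p - coord q) <= 2%:R^-1 ^+ n.+1).

Lemma chart_ball_refl n p : chart_ball n p p.
Proof. by rewrite /chart_ball eqxx subrr (dabs0 hN) exprn_ge0 // invr_ge0. Qed.

Lemma chart_ball_sym n p q : chart_ball n p q = chart_ball n q p.
Proof. by rewrite /chart_ball eq_sym (dabsB hN). Qed.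

Lemma chart_ball_trans n q p r : chart_ball n p q -> chart_ball n q r -> chart_ball n p r.
Proof.
move=> /andP[/eqP s1 h1] /andP[/eqP s2 h2]; rewrite /chart_ball s1 s2 eqxx /=.
have -> : coord p - coord r = (coord p - coord q) + (coord q - coord r) by ring.
exact: (dabs_le hN).
Qed.

Lemma chart_ballE n p q : chart_ball n p q = (cross_dist p q <= 4%:R^-1 ^+ n.+1).
Proof.
rewrite /chart_ball /cross_dist; case: eqP => _ /=; last first.
  apply/esym/negbTE; rewrite -ltNge; apply: le_lt_trans (_ : 4%:R^-1 < _); last by lra.
  by rewrite exprS ler_piMr // exprn_ile1.
have -> : (4%:R^-1 : rat) ^+ n.+1 = (2%:R^-1 ^+ n.+1) ^+ 2 by rewrite -exprM mulnC exprM.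
by rewrite ler_sqr // ?nnegrE ?(dabs_ge0 hN) // exprn_ge0.
Qed.

Lemma chart_ball_mob n p q : chart_ball n (phi p) (phi q) = chart_ball n p q.
Proof. by rewrite !chart_ballE cross_dist_mob. Qed.

Lemma chart_ball_le n m p q : (n <= m)%N -> chart_ball m p q -> chart_ball n p q.
Proof.
move=> nm /andP[sE h]; rewrite /chart_ball sE /=; apply: le_trans h _.
by rewrite ler_wiXn2l // ?invr_ge0 // invf_le1.
Qed.

(* The residue field has two elements. *)
Lemma chart_ball_three n p q r :
  chart_ball n p q -> ~~ chart_ball n.+1 p q ->
  chart_ball n p r -> ~~ chart_ball n.+1 p r -> chart_ball n.+1 q r.
Proof.
move=> /andP[/eqP s1 h1]; rewrite /chart_ball s1 eqxx /= => h1'.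
move=> /andP[/eqP s2 h2]; rewrite s2 eqxx /= => h2'.
have E t : N t <= 2%:R^-1 ^+ n.+1 -> ~~ (N t <= 2%:R^-1 ^+ n.+2) -> N t = 2%:R^-1 ^+ n.+1.
  move=> t1 t2; apply/eqP; rewrite eq_le t1 leNgt; apply: contra t2; exact:
    (dabs_lt_half hN).
have e1 := E _ h1 h1'; have e2 := E _ h2 h2'.
have := dabs_eq_half hN (etrans e2 (esym e1)).
have -> : coord p - coord r - (coord p - coord q) = coord q - coord r by ring.
by rewrite e2 (exprS _ n.+1) mulrC.
Qed.

Hypothesis u_neq0 : forall k, (0 < k)%N -> (mob_pow a b c d k).1 != 0.

Lemma cross_dist_iter_gt0 k p : (0 < k)%N -> 0 < cross_dist (iter k phi p) p.
Proof.
move=> k0; have dN : 0 < N delta ^+ k by rewrite exprn_gt0 // (dabs_gt0 hN).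
rewrite -(pmulr_lgt0 _ dN) cross_dist_iter pmulr_lgt0.
  by rewrite (dabs_gt0 hN) DeltaE mulf_neq0 ?expf_neq0 // -(dabs_eq0 hN) Nj1.
by rewrite exprn_gt0 // (dabs_gt0 hN) u_neq0.
Qed.

(** Repeated doubling yields iterates that move every point by exactly the distance of level
    [m + j']: they stay in its ball of that level and leave its ball of the next. *)
Lemma chart_ball_return k p0 : (0 < k)%N -> chart_ball 1 (iter k phi p0) p0 ->
  exists m, forall j', exists k', forall p,
    chart_ball (m + j') (iter k' phi p) p /\ ~~ chart_ball (m + j').+1 (iter k' phi p) p.
Proof.
move=> k0 h.
have cstE k' p p' : cross_dist (iter k' phi p) p = cross_dist (iter k' phi p') p'.
  have dN : N delta ^+ k' != 0 by rewrite expf_neq0 // (dabs_eq0 hN).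
  by apply: (mulIf dN); rewrite !cross_dist_iter.
(* Level 1 means distance at most 4^-2, hence [m >= 1], and [cross_dist_double] applies from the
   start. *)
have [m [m0 mE]] : exists m,
  (1 <= m)%N /\ cross_dist (iter k phi p0) p0 = 4%:R^-1 ^+ m.+1.
  move: h (cross_dist_iter_gt0 p0 k0); rewrite /cross_dist => /andP[/eqP-> le1].
  rewrite eqxx => gt0; have n0 : coord (iter k phi p0) - coord p0 != 0.
    by rewrite -(dabs_eq0 hN) -sqrf_eq0 gt_eqF.
  have [m m2 ->] := dabs_le1_exp hN n0 le1; exists m.-1.
  case: m m2 => // m m2; split => //.
  by rewrite -exprM mulnC exprM.
exists m => j'; exists (k * 2 ^ j')%N => p.
have E : cross_dist (iter (k * 2 ^ j') phi p) p = 4%:R^-1 ^+ (m + j').+1.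
  elim: j' => [|j' IH]; first by rewrite expn0 muln1 addn0 (cstE _ _ p0).
  rewrite expnS mul2n -addnn mulnDr cross_dist_double IH.
    by rewrite addnS (exprS _ (m + j').+1) mulrC.
  have -> : (16%:R^-1 : rat) = 4%:R^-1 ^+ 2 by [].
  by rewrite ler_iXn2l //; lia.
rewrite !chart_ballE E lexx; split => //; rewrite -ltNge.
by rewrite (exprS _ (m + j').+1) gtr_pMl ?exprn_gt0.
Qed.

(** Induction on the level. A ball has two halves; if the current iterate of [p] lies in the half
    without [q], the iterate from [chart_ball_return] that moves all points by exactly this level
    takes it to the other half. *)
Lemma chart_ball_orbit_dense k p0 : (0 < k)%N -> chart_ball 1 (iter k phi p0) p0 ->
  exists m, forall p q, chart_ball m p q ->
    forall n, exists k', chart_ball n (iter k' phi p) q.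
Proof.
move=> k0 /(chart_ball_return k0)[m H]; exists m => p q pq n.
suff [k' h] : exists k', chart_ball (m + n) (iter k' phi p) q.
  by exists k'; apply: chart_ball_le h; rewrite leq_addl.
elim: n => [|n [k' IH]]; first by exists 0%N; rewrite addn0.
rewrite addnS; have [|h] := boolP (chart_ball (m + n).+1 (iter k' phi p) q).
  by exists k'.
have [k'' /(_ (iter k' phi p))[h1 h2]] := H n.
exists (k'' + k')%N; rewrite iterD; move: h1 h2.
rewrite chart_ball_sym (chart_ball_sym (m + n).+1) => h1 h2.
exact: chart_ball_three h1 h2 IH h.
Qed.

End chart.

(** * Residue field, compactness and Haar measure of Z_2 *)

Lemma rat_Q2B (p q : rat) : rat_Q2 (p - q) = rat_Q2 p - rat_Q2 q.
Proof. by apply: (addIr (rat_Q2 q)); rewrite -rat_Q2D !subrK. Qed.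

Lemma abs2_int_even (m : int) : (2 %| `|m|)%N -> abs2 m%:~R <= 2%:R^-1.
Proof.
have [->|m0] := eqVneq m 0; first by rewrite abs2_0 invr_ge0.
move=> m2; have l0 : (0 < logn 2 `|m|)%N.
  by rewrite logn_gt0 mem_primes absz_gt0 m0 m2.
rewrite abs2_intE // lef_pV2 ?posrE ?exprn_gt0 //.
by rewrite -{1}(expr1 (2%:R : rat)) ler_eXn2l.
Qed.

Lemma abs2_residue (q : rat) : abs2 q <= 1 ->
  abs2 q <= 2%:R^-1 \/ abs2 (q - 1) <= 2%:R^-1.
Proof.
move=> /abs2_denq d1.
have den0 : ((denq q)%:~R : rat) != 0 by rewrite intr_eq0 denq_eq0.
have [n2|n2] := boolP (2 %| `|numq q|)%N; [left|right].
  by rewrite -(divq_num_den q) abs2M abs2V d1 invr1 mulr1 abs2_int_even.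
have -> : q - 1 = (numq q - denq q)%:~R / (denq q)%:~R.
  by rewrite rmorphB /= mulrBl divq_num_den divff.
rewrite abs2M abs2V d1 invr1 mulr1 abs2_int_even //.
have : ~~ (2 %| `|denq q|)%N.
  by apply/negP => /abs2_int_even; rewrite d1.
by move: n2; lia.
Qed.

Lemma absQ2_residue (x : Q2) : absQ2 x <= 1 ->
  absQ2 x <= 2%:R^-1 \/ absQ2 (x - 1) <= 2%:R^-1.
Proof.
move=> x1; have [//|q xq] := @absQ2_dense x 2%:R^-1.
have step y : abs2 (q - y) <= 2%:R^-1 -> absQ2 (x - rat_Q2 y) <= 2%:R^-1.
  move=> h2; have E : rat_Q2 q = rat_Q2 (q - y) + rat_Q2 y by rewrite -rat_Q2D subrK.
  have -> : x - rat_Q2 y = (x - rat_Q2 q) + rat_Q2 (q - y) by rewrite E; ring.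
  by apply: le_trans (absQ2_le_max _ _) _; rewrite ge_max xq absQ2_rat.
have q1 : abs2 q <= 1.
  have -> : abs2 q = absQ2 (x + - (x - rat_Q2 q)) by rewrite subKr absQ2_rat.
  apply: le_trans (absQ2_le_max _ _) _; rewrite ge_max x1 absQ2N.
  by apply: le_trans xq _; rewrite invf_le1.
have [h|h] := abs2_residue q1; [left|right].
  by have := step 0; rewrite subr0 (rat_Q2_nat 0) subr0; exact.
by have := step 1; rewrite (rat_Q2_nat 1); exact.
Qed.

Lemma dyadic_absQ2 : dyadic_abs absQ2.
Proof.
split; [|exact: absQ2M|exact: absQ2_le_max|exact: absQ2_2|split].
- by move=> x; have := absQ2_gt0 x; rewrite lt_def absQ2_ge0 andbT => /(congr1 negb);
  rewrite !negbK.
- exact: absQ2_exp2.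
- exact: absQ2_residue.
Qed.

Lemma half_exp_lt (e : rat) : 0 < e -> exists n, 2%:R^-1 ^+ n < e.
Proof.
move=> e0; exists (Num.bound e^-1).
rewrite exprVn -[ltRHS]invrK ltf_pV2 ?posrE ?exprn_gt0 ?invr_gt0 //.
exact: upper_nthrootP.
Qed.

Definition closed_ballQ2 (x : Q2) (n : nat) :
  set Q2 := [set y | absQ2 (x - y) <= 2%:R^-1 ^+ n].

Lemma closed_ballQ2_trans n x y z :
  closed_ballQ2 x n y -> closed_ballQ2 y n z -> closed_ballQ2 x n z.
Proof.
rewrite /closed_ballQ2 /= => h1 h2; have -> : x - z = (x - y) + (y - z) by ring.
exact: (dabs_le dyadic_absQ2).
Qed.

Lemma closed_ballQ2_sym n x y : closed_ballQ2 x n y -> closed_ballQ2 y n x.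
Proof. by rewrite /closed_ballQ2 /= (dabsB dyadic_absQ2). Qed.

Lemma absQ2_two_exp n : absQ2 (2%:R ^+ n) = 2%:R^-1 ^+ n.
Proof. by rewrite (dabsX dyadic_absQ2) absQ2_2. Qed.

Lemma Q2_two_neq0 : (2%:R : Q2) != 0.
Proof. by rewrite -absQ2_gt0 absQ2_2. Qed.

Lemma closed_ballQ2_split n x y : closed_ballQ2 x n y ->
  closed_ballQ2 x n.+1 y \/ closed_ballQ2 (x + 2%:R ^+ n) n.+1 y.
Proof.
rewrite /closed_ballQ2 /= => xy.
have t0 : (2%:R : Q2) ^+ n != 0 by apply: expf_neq0; exact: Q2_two_neq0.
have [z zE] : exists z, y - x = 2%:R ^+ n * z.
  by exists ((2%:R ^+ n)^-1 * (y - x)); rewrite mulVKf.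
have Nz : absQ2 z <= 1.
  move: xy; rewrite (dabsB dyadic_absQ2) zE (dabsM dyadic_absQ2) absQ2_two_exp.
  by rewrite ger_pMr // exprn_gt0 // invr_gt0.
have [h|h] := absQ2_residue Nz; [left|right].
  rewrite (dabsB dyadic_absQ2) zE (dabsM dyadic_absQ2) absQ2_two_exp exprS mulrC.
  by rewrite ler_wpM2r // exprn_ge0 // invr_ge0.
have -> : x + 2%:R ^+ n - y = - (2%:R ^+ n * (z - 1)).
  have -> : y = x + 2%:R ^+ n * z by rewrite -zE addrC subrK.
  by ring.
rewrite (dabsN dyadic_absQ2) (dabsM dyadic_absQ2) absQ2_two_exp exprS mulrC.
by rewrite ler_wpM2r // exprn_ge0 // invr_ge0.
Qed.

Lemma closed_ballQ2_shift n (x : Q2) : ~ closed_ballQ2 x n.+1 (x + 2%:R ^+ n).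
Proof.
rewrite /closed_ballQ2 /=; have -> : x - (x + 2%:R ^+ n) = - 2%:R ^+ n by ring.
rewrite (dabsN dyadic_absQ2) absQ2_two_exp; apply/negP; rewrite -ltNge.
by rewrite exprS gtr_pMl ?exprn_gt0 // invf_lt1.
Qed.

Lemma closed_ballQ2_nat n x : Z2 x -> exists2 k, (k < 2 ^ n)%N & closed_ballQ2 k%:R n x.
Proof.
move=> x1; elim: n => [|n [k kn /closed_ballQ2_split[h|h]]].
- by exists 0%N => //; rewrite /closed_ballQ2 /= sub0r absQ2N expr0.
- by exists k => //; rewrite expnS mul2n -addnn ltn_addr.
- exists (k + 2 ^ n)%N; first by rewrite expnS mul2n -addnn ltn_add2r.
  by rewrite natrD natrX.
Qed.

Lemma nbhs_closed_ballQ2 (x : Q2) n : nbhs x (closed_ballQ2 x n).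
Proof.
apply/nbhs_ballP; exists (2%:R^-1 ^+ n) => /=; first by rewrite exprn_gt0 // invr_gt0.
by move=> y; rewrite ballEmdist /closed_ballQ2 /= => /ltW.
Qed.

Lemma nbhs_closed_ballQ2P (x : Q2) (U : set Q2) :
  nbhs x U -> exists n, closed_ballQ2 x n `<=` U.
Proof.
move=> /nbhs_ballP[e /= e0 eU]; have [n ne] := half_exp_lt e0.
exists n => y; rewrite /closed_ballQ2 /= => h; apply: eU.
by rewrite ballEmdist /=; apply: le_lt_trans ne.
Qed.

Lemma closed_ballQ2_open n x : open (closed_ballQ2 x n).
Proof.
rewrite openE => y xy; rewrite /interior.
apply: filterS (nbhs_closed_ballQ2 y n) => z; exact: closed_ballQ2_trans.
Qed.

Lemma Z2_closed_ball : Z2 = closed_ballQ2 0 0.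
Proof. by apply/seteqP; split=> x; rewrite /closed_ballQ2 /= sub0r absQ2N expr0. Qed.

(** Bisection: an ultrafilter on Z_2 contains one ball of each radius 2^-n with an integer centre.
    The centres form a Cauchy sequence of rationals, whose class is the limit. *)
Lemma compact_Z2 : compact Z2.
Proof.
rewrite compact_ultra => F FU FZ.
have FF : ProperFilter F by exact: ultra_proper.
have /choice[k kF] : forall n, exists k, F (closed_ballQ2 (k%:R : Q2) n).
  elim=> [|n [k kF]]; first by exists 0%N; rewrite -Z2_closed_ball.
  have [h|h] := in_ultra_setVsetC (closed_ballQ2 (k%:R : Q2) n.+1) FU.
    by exists k.
  exists (k + 2 ^ n)%N; apply: filterS2 kF h => x xk xk'.
  by have [|] := closed_ballQ2_split xk; rewrite ?natrD ?natrX.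
(* The balls were chosen independently for each level; that they are nested follows since two
   members of the filter meet. *)
have kk n m : (n <= m)%N -> absQ2 ((k n)%:R - (k m)%:R) <= 2%:R^-1 ^+ n.
  move=> nm; have [x [xn xm]] := filter_ex (filterI (kF n) (kF m)).
  apply: closed_ballQ2_trans xn (closed_ballQ2_sym _).
  by apply: le_trans xm _; rewrite ler_wiXn2l // ?invr_ge0 // invf_le1.
have kk2 n m : (n <= m)%N -> abs2 ((k n)%:R - (k m)%:R) <= 2%:R^-1 ^+ n.
  by move=> /kk; rewrite -!rat_Q2_nat -rat_Q2B absQ2_rat.
have uC : (fun n => (k n)%:R : rat) \in cauchy2_pred.
  apply/asboolP => e /half_exp_lt[N Ne]; exists N => m n Nm Nn.
  apply: le_lt_trans Ne; rewrite -[X in X - _](subrK (k N)%:R) -addrA.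
  apply: le_trans (abs2D _ _) _; rewrite ge_max kk2 // andbT.
  by rewrite abs2B kk2.
pose x : Q2 := \pi_Q2 (CauchySeq uC).
have xk n : closed_ballQ2 (k n)%:R n x.
  rewrite /closed_ballQ2 /= -rat_Q2_nat (dabsB dyadic_absQ2) /x -Q2_piN -Q2_piD.
  apply: cvgr_to_le (absQ2_pi _) _; exists n => // m /= nm.
  by rewrite abs2B; exact: kk2.
exists x; split.
  have [y [yZ yk]] := filter_ex (filterI FZ (kF 0%N)).
  rewrite Z2_closed_ball; apply: closed_ballQ2_trans (xk 0%N).
  by apply: closed_ballQ2_trans (closed_ballQ2_sym yk); rewrite -Z2_closed_ball.
move=> U /nbhs_closed_ballQ2P[n nU]; apply: filterS (kF n) => y ky; apply: nU.
exact: closed_ballQ2_trans (closed_ballQ2_sym (xk n)) ky.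
Qed.

Lemma measurable_closed_ballQ2 n x : measurable (closed_ballQ2 x n : set Q2_borel).
Proof. by apply: sub_sigma_algebra; exact: closed_ballQ2_open. Qed.

Lemma closed_ballQ2_exp n : closed_ballQ2 0 n (2%:R ^+ n).
Proof. by rewrite /closed_ballQ2 /= sub0r absQ2N absQ2_two_exp. Qed.

Lemma closed_ballQ2_le n m x : (m <= n)%N -> closed_ballQ2 x n `<=` closed_ballQ2 x m.
Proof. by move=> mn y h; apply: le_trans h _; rewrite ler_wiXn2l //
  ?invr_ge0 // invf_le1. Qed.

(** Translates have equal mass and each ball is the disjoint union of two balls of the next level,
    so the mass halves at each level. *)
Lemma haar_Z2_ball (R : realType) (mu0 : probability Q2_borel R) n x :
  haar_Z2 mu0 -> Z2 x -> mu0 (closed_ballQ2 x n) = (2%:R^-1 ^+ n)%:E.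
Proof.
move=> [mZ mT] xZ.
have sub m : closed_ballQ2 0 m `<=` Z2.
  by rewrite Z2_closed_ball; exact: closed_ballQ2_le.
have tr y m : Z2 y -> mu0 (closed_ballQ2 y m) = mu0 (closed_ballQ2 0 m).
  move=> yZ; rewrite -(mT y _ yZ (measurable_closed_ballQ2 m 0) (@sub m)).
  congr (mu0 _); apply/seteqP; split => [z h|_ [z h <-]];
    rewrite /closed_ballQ2 /= in h *.
    exists (z - y); last by rewrite addrC subrK.
    by rewrite sub0r opprB.
  by rewrite opprD addrA subrr.
rewrite tr //; elim: n => [|n IH]; first by rewrite -Z2_closed_ball expr0.
have U : closed_ballQ2 0 n = closed_ballQ2 0 n.+1 `|` closed_ballQ2 (2%:R ^+ n) n.+1.
  apply/seteqP; split => [z /closed_ballQ2_split|z []]; first by rewrite add0r.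
  - exact: closed_ballQ2_le.
  - move=> /(closed_ballQ2_le (leqnSn n)); apply: closed_ballQ2_trans.
    exact: closed_ballQ2_exp.
have add : mu0 (closed_ballQ2 0 n) =
    (mu0 (closed_ballQ2 0%R n.+1) + mu0 (closed_ballQ2 (2%:R ^+ n)%R n.+1))%E.
  rewrite U; apply: measureU; [exact: measurable_closed_ballQ2|exact:
    measurable_closed_ballQ2|].
  apply/seteqP; split => // z [z0 z1].
  have := closed_ballQ2_trans z0 (closed_ballQ2_sym z1).
  by rewrite -[X in closed_ballQ2 _ _ X]add0r => /closed_ballQ2_shift.
move: IH; rewrite add (tr (2%:R ^+ n)); last by apply: sub; exact: closed_ballQ2_exp.
have fin : mu0 (closed_ballQ2 0 n.+1) \is a fin_num by exact:
  fin_num_measure (measurable_closed_ballQ2 _ _).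
rewrite -(fineK fin) -EFinD => -[]; set r := fine _ => rE.
by congr (_%:E); rewrite exprS; lra.
Qed.

(** * Invariant measures of isometries on a space with finite partitions into balls *)

(** The balls of level [n] are the classes of the equivalence relation [E n]. The list [s n] meets
    all of them, so they are finite in number. *)
Definition ball_frame (T : ptopologicalType) (E : nat -> T -> T -> bool)
    (s : nat -> seq T) : Prop :=
  [/\ forall n x, E n x x,
      forall n x y, E n x y = E n y x,
      forall n y x z, E n x y -> E n y z -> E n x z,
      forall n m x y, (n <= m)%N -> E m x y -> E n x y &
      [/\ forall n x, open [set y | E n x y],
          forall (U : set T) x, open U -> U x -> exists n, [set y | E n x y] `<=` U &
          forall n x, exists2 y, y \in s n & E n y x]].

Section ball_frame_theory.
Context (R : realType) (T : ptopologicalType) (E : nat -> T -> T -> bool)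
  (s : nat -> seq T) (frame : ball_frame E s).
Let Erefl n x : E n x x. Proof. by case: frame. Qed.
Let Esym n x y : E n x y = E n y x. Proof. by case: frame. Qed.
Let Etrans n y x z : E n x y -> E n y z -> E n x z.
Proof. by case: frame => _ _ H _ _; exact: H. Qed.
Let Ele n m x y : (n <= m)%N -> E m x y -> E n x y.
Proof. by case: frame => _ _ _ H _; exact: H. Qed.
Let Eopen n x : open [set y | E n x y]. Proof. by case: frame => _ _ _ _ []. Qed.
Let Ebase (U : set T) x : open U -> U x -> exists n, [set y | E n x y] `<=` U.
Proof. by case: frame => _ _ _ _ [_ H _]; exact: H. Qed.
Let Efin n x : exists2 y, y \in s n & E n y x.
Proof. by case: frame => _ _ _ _ [_ _ H]; exact: H. Qed.
Notation TB := (g_sigma_algebraType (@open T)).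
Implicit Types (mu nu : probability TB R).

(** Two balls are nested or disjoint, so with the empty set added this is a pi-system. *)
Definition ball_sets : set (set TB) :=
  [set A | A = set0 \/ exists n x, A = [set y | E n x y]].

Let cyl_subset n x y : E n x y -> [set z | E n y z] `<=` [set z | E n x z].
Proof. by move=> xy z; exact: Etrans. Qed.

Let cyl_eq n x y : E n x y -> [set z | E n x z] = [set z | E n y z].
Proof.
by move=> xy; apply/seteqP; split; apply: cyl_subset => //; rewrite Esym.
Qed.

Lemma ball_sets_setI : setI_closed ball_sets.
Proof.
move=> _ _ [->|[n [x ->]]] [->|[m [y ->]]]; rewrite ?set0I ?setI0; do ?[by left].
have [[z [xz yz]]|h] := pselect ([set z | E n x z] `&` [set z | E m y z] !=set0);
  last first.
  by left; apply/eqP; apply/negPn; apply/negP => /set0P.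
right; have [nm|/ltnW mn] := leqP n m.
  exists m, z; apply/seteqP; split => [t [_ yt]|t zt] /=.
    by apply: Etrans yt; rewrite Esym.
  by split; [apply: (@Etrans _ z) => //; exact: Ele zt|exact: Etrans zt].
exists n, z; apply/seteqP; split => [t [xt _]|t zt] /=.
  by apply: Etrans xt; rewrite Esym.
by split; [exact: Etrans zt|apply: (@Etrans _ z) => //; exact: Ele zt].
Qed.

Lemma measurable_ball n x : measurable ([set y | E n x y] : set TB).
Proof. by apply: sub_sigma_algebra; exact: Eopen. Qed.

Lemma ball_sets_gen : (measurable : set (set TB)) = <<s ball_sets >>.
Proof.
apply/seteqP; split.
  apply: smallest_sub; first exact: smallest_sigma_algebra.
  move=> U oU.
  (* Past the end of [s n] this is the ball around [point]; like any other ball, it enters the union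
     only if it lies in [U]. *)
  pose C n k := [set y | E n (nth point (s n) k) y].
  have -> : U = \bigcup_n \bigcup_(k in [set k | C n k `<=` U]) C n k.
    apply/seteqP; split => [x Ux|x [n _ [k kU]]]; last exact: kU.
    have [n nU] := Ebase oU Ux; exists n => //.
    have [y ys yx] := Efin n x.
    have Cy : C n (index y (s n)) = [set z | E n x z].
      by rewrite /C nth_index //; exact: cyl_eq.
    by exists (index y (s n)); rewrite /= Cy /=.
  have sa := smallest_sigma_algebra setT ball_sets.
  apply: sigma_algebra_bigcup => n.
  rewrite bigcup_mkcond; apply: sigma_algebra_bigcup => k.
  case: ifP => _; last exact: sigma_algebra0.
  by apply: sub_sigma_algebra; right; exists n, (nth point (s n) k).
apply: smallest_sub; first exact: sigma_algebra_measurable.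
by move=> _ [->|[n [x ->]]]; [exact: measurable0|exact: measurable_ball].
Qed.

Lemma eq_measure_balls (mu nu : {measure set TB -> \bar R}) :
  (mu setT < +oo)%E ->
  (forall n x, mu [set y | E n x y] = nu [set y | E n x y]) ->
  forall A, measurable A -> mu A = nu A.
Proof.
move=> muT H; pose g k := [set y | E 0 (nth point (s 0%N) k) y].
apply: (measure_unique ball_sets g).
- exact: ball_sets_gen.
- exact: ball_sets_setI.
- by move=> k; right; exists 0%N, (nth point (s 0%N) k).
- apply/seteqP; split => // x _; have [y ys yx] := Efin 0 x.
  by exists (index y (s 0%N)) => //; rewrite /g nth_index.
- by move=> _ [->|[n [x ->]]]; rewrite ?measure0.
- move=> k; apply: le_lt_trans muT; apply: le_measure; rewrite ?inE //.
  exact: measurable_ball.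
Qed.

(** [s n] may list several points of one ball. Taking the first one gives each ball a unique
    number. *)
Definition ball_index n x := find (fun z => E n z x) (s n).

Lemma ball_index_lt n x : (ball_index n x < size (s n))%N.
Proof. by rewrite -has_find; apply/hasP; have [y ys yx] := Efin n x; exists y. Qed.

Lemma ball_indexP n x y : ball_index n x = ball_index n y <-> E n x y.
Proof.
have H z : E n (nth point (s n) (ball_index n z)) z.
  by have := ball_index_lt n z; rewrite -has_find => /(nth_find point).
split => [h|xy].
  apply: (@Etrans _ (nth point (s n) (ball_index n x))); first by rewrite Esym.
  by rewrite h.
apply: eq_find => z; apply/idP/idP => h; apply: Etrans h _ => //.
by rewrite Esym.
Qed.

Variables (phi : T -> T) (phiE : forall n x y, E n (phi x) (phi y) = E n x y)
  (phi_surj : forall y, exists x, phi x = y).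

(** By pigeonhole two iterates of [x] lie in the same ball of level [n]; the isometry cancels the
    common iterations. *)
Lemma isometry_recurrence n x : exists2 k, (0 < k)%N & E n (iter k phi x) x.
Proof.
pose code (k : 'I_(size (s n)).+1) := Ordinal (ball_index_lt n (iter k phi x)).
have /injectivePn[k1 [k2 k12 codeE]] : ~~ injectiveb code.
  by apply/injectiveP => /leq_card; rewrite !card_ord ltnn.
have : E n (iter k1 phi x) (iter k2 phi x) by apply/ball_indexP; have := congr1 val codeE.
have iterE k y z : E n (iter k phi y) (iter k phi z) = E n y z.
  by elim: k => //= k <-; rewrite phiE.
have main (m1 m2 : nat) : (m1 < m2)%N -> E n (iter m1 phi x) (iter m2 phi x) ->
    exists2 k, (0 < k)%N & E n (iter k phi x) x.
  move=> lt12; rewrite -(subnKC (ltnW lt12)) iterD iterE Esym => h.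
  by exists (m2 - m1)%N; rewrite ?subn_gt0.
have [lt12|lt21|eq12] := ltngtP (k1 : nat) k2; first exact: main.
  by rewrite Esym; exact: main.
by rewrite (val_inj eq12) eqxx in k12.
Qed.

Lemma preimage_ball n x : phi @^-1` [set y | E n (phi x) y] = [set y | E n x y].
Proof. by apply/seteqP; split => y /=; rewrite phiE. Qed.

Lemma measurable_isometry : measurable_fun setT (phi : TB -> TB).
Proof.
apply: (measurability ball_sets); first exact: ball_sets_gen.
move=> _ [_ [->|[n [y ->]]] <-]; first by rewrite preimage_set0 setI0; exact: measurable0.
by have [x <-] := phi_surj y; rewrite preimage_ball setTI; exact: measurable_ball.
Qed.

Variable B : set T.
Hypotheses (B0 : B !=set0) (phiB : phi @` B `<=` B)
  (Bmin : forall x, B x -> B = closure (range (fun n : nat => iter n phi x))).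

(** [invariant_prob] for a general space; the two are convertible on [PQ2]. *)
Definition invariant_on (tau : set TB -> \bar R) : Prop :=
  tau B = 1%E /\ forall A : set TB, measurable A -> A `<=` B ->
    tau (B `&` phi @^-1` A) = tau A.

Lemma measurable_minimal : measurable (B : set TB).
Proof.
have [x Bx] := B0; rewrite (Bmin Bx) -[X in measurable X]setCK.
apply: measurableC; apply: sub_sigma_algebra.
by apply: closed_openC; exact: closed_closure.
Qed.
Let mB := measurable_minimal.

Definition ball_count n :=
  #|[pred k : 'I_(size (s n)) | `[< exists2 x, B x & ball_index n x = k >]]|.

Section invariant_measure.
Variables (tau : probability TB R) (htau : invariant_on tau).

Let tauB A : measurable A -> tau A = tau (B `&` A).
Proof.
move=> mA; have [tB _] := htau.
rewrite -[in LHS](setIT A) -(setUv B) setIUr measureU //.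
- rewrite setIC [X in (_ + X)%E](_ : _ = 0%E) ?adde0 //.
  have tC : tau (~` B) = 0%E by rewrite probability_setC // tB subee.
  apply/eqP; rewrite eq_le measure_ge0 andbT -tC.
  apply: le_measure; rewrite ?inE; last by move=> ? [].
    by apply: measurableI => //; apply: measurableC.
  exact: measurableC.
- exact: measurableI.
- by apply: measurableI => //; apply: measurableC.
- by rewrite setIACA setICr setI0.
Qed.

Let tau_phi n x : tau [set y | E n (phi x) y] = tau [set y | E n x y].
Proof.
have [tB H] := htau.
rewrite tauB; last exact: measurable_ball.
rewrite -H; [|by apply: measurableI => //; apply: measurable_ball|by move=> ? []].
rewrite [RHS]tauB; last exact: measurable_ball.
congr (tau _); rewrite preimage_setI preimage_ball; apply/seteqP.
by split => y /=; [case=> ? []|case=> By ?; split => //; split => //; apply: phiB;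
  exists y].
Qed.

(** By minimality the orbit of [x] enters the ball of [y], and by [tau_phi] the mass of the ball is
    constant along the orbit. *)
Let tau_eq n x y : B x -> B y -> tau [set z | E n x z] = tau [set z | E n y z].
Proof.
move=> Bx By; have : closure (range (fun n : nat => iter n phi x)) y by rewrite -Bmin.
move=> /(_ [set z | E n y z]) /(_ (open_nbhs_nbhs (conj (Eopen n y) (Erefl n y)))).
move=> [_ [[k _ <-] /cyl_eq ->]].
by elim: k => //= k ->; rewrite tau_phi.
Qed.

Lemma invariant_out n x : (forall y, B y -> ~~ E n x y) -> tau [set y | E n x y] = 0%E.
Proof.
move=> h; rewrite tauB; last exact: measurable_ball.
rewrite (_ : B `&` _ = set0) ?measure0 //.
by apply/seteqP; split => // y [/h /negP].
Qed.

(* By minimality the balls of level [n] that meet [B] have equal masses, so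
   these masses are determined by the number of such balls. *)
Lemma invariant_count n x : B x -> fine (tau [set y | E n x y]) *+ ball_count n = 1.
Proof.
move=> Bx; pose C (k : 'I_(size (s n))) := [set y | ball_index n y = k].
have CE k y : C k y -> C k = [set z | E n y z].
  move=> yk; apply/seteqP; split => z /=; first by move=> zk; apply/ball_indexP;
    rewrite (zk : ball_index n z = k).
  by move=> yz; apply: etrans yk; apply/ball_indexP; rewrite Esym.
have mC k : measurable (C k : set TB).
  have [->|/set0P[y yk]] := eqVneq (C k) set0; first exact: measurable0.
  by rewrite (CE _ _ yk); exact: measurable_ball.
have U1 : tau (\big[setU/set0]_(k < size (s n)) C k) = 1%E.
  rewrite -(probability_setT tau); congr (tau _); apply/seteqP; split => // y _.
  by rewrite (bigD1 (Ordinal (ball_index_lt n y))) //=; left.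
apply: EFin_inj; rewrite -U1 (measure_bigsetU_ord _ predT) //; last first.
  by move=> k l _ _ [y [yk yl]]; apply: val_inj; rewrite /= -yk -yl.
rewrite /ball_count -sumr_const big_mkcond -sumEFin; apply: eq_bigr => k _.
have fin : tau [set z | E n x z] \is a fin_num.
  by apply: fin_num_measure; exact: measurable_ball.
case: ifPn => kP; move: kP; rewrite unfold_in /= => /asboolP.
  by move=> [y By yk]; rewrite (CE _ _ yk) fineK //; exact: tau_eq.
move=> h; have [->|/set0P[y yk]] := eqVneq (C k) set0; first by rewrite measure0.
rewrite (CE _ _ yk); apply/esym/invariant_out => z Bz; apply/negP => yz; apply: h.
by exists z => //; rewrite -(yk : ball_index n y = k); apply/ball_indexP; rewrite Esym.
Qed.
End invariant_measure.

Lemma invariant_on_unique (tau tau' : probability TB R) :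
  invariant_on tau -> invariant_on tau' -> forall A, measurable A -> tau A = tau' A.
Proof.
move=> h h'; have tT : (tau setT < +oo)%E by rewrite probability_setT ltry.
apply: eq_measure_balls tT _ => n x; have [[y By xy]|nB] := pselect (exists2 y,
  B y & E n x y).
  rewrite (cyl_eq xy); have h2 := invariant_count h' n By;
    have h1 := invariant_count h n By.
  have fin (m : probability TB R) : m [set z | E n y z] \is a fin_num.
    by apply: fin_num_measure; exact: measurable_ball.
  have n0 : (0 < ball_count n)%N.
    by move: h1; case: (ball_count n) => //; rewrite mulr0n => /esym/eqP;
      rewrite oner_eq0.
  rewrite -[LHS](fineK (fin tau)) -[RHS](fineK (fin tau')).
  by apply/eqP; rewrite eqe -(eqr_pMn2r n0) h1 h2.
have out z : B z -> ~~ E n x z by move=> Bz; apply/negP => xz; apply: nB; exists z.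
by transitivity (0%E : \bar R); [exact: (invariant_out h)|exact/esym/(invariant_out h')].
Qed.

Variables (mu : {measure set TB -> \bar R}).
Hypotheses (mu_fin : (mu setT < +oo)%E)
  (mu_phi : forall n x, mu [set y | E n (phi x) y] = mu [set y | E n x y])
  (muB : (0 < mu B)%E).

Lemma isometry_preserves (A : set TB) : measurable A -> mu (phi @^-1` A) = mu A.
Proof.
move=> mA; apply/esym.
unshelve refine (@eq_measure_balls mu (pushforward mu (phi : TB -> TB)) mu_fin _ A mA).
  exact: measurable_isometry.
by move=> n x; have [y <-] := phi_surj x; rewrite /= /pushforward preimage_ball.
Qed.

Let mu_measurable_fin (A : set TB) : measurable A -> mu A \is a fin_num.
Proof.
move=> mA; rewrite ge0_fin_numE //; apply: le_lt_trans mu_fin.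
by apply: le_measure; rewrite ?inE.
Qed.

Let measurable_preimage (A : set TB) : measurable A -> measurable (phi @^-1` A : set TB).
Proof. by move=> mA; rewrite -[X in measurable X]setTI; exact: measurable_isometry. Qed.

Lemma isometry_preserves_minimal (A : set TB) : measurable A -> A `<=` B ->
  mu (B `&` phi @^-1` A) = mu A.
Proof.
move=> mA AB; have mpA := measurable_preimage mA; have mpB := measurable_preimage mB.
have null : mu (phi @^-1` B `\` B) = 0%E.
  have : mu B = (mu (phi @^-1` B `\` B) + mu B)%E.
    rewrite -[LHS](isometry_preserves mB) [LHS](measureDI mu mpB mB).
    by congr (_ + mu _)%E; apply/seteqP; split => [x []|x Bx] //; split => //; apply:
      phiB; exists x.
  have finD : mu (phi @^-1` B `\` B) \is a fin_num by apply: mu_measurable_fin; exact: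
    measurableD.
  rewrite -(fineK (mu_measurable_fin mB)) -(fineK finD) -EFinD => -[] E0.
  by congr (_%:E); lra.
rewrite -(isometry_preserves mA) [RHS](measureDI mu mpA mB) setIC.
rewrite -[LHS]add0e; congr (_ + _)%E; apply/esym.
apply/eqP; rewrite eq_le measure_ge0 andbT -null.
apply: le_measure; rewrite ?inE; [exact: measurableD|exact: measurableD|].
by move=> x [/AB ? ?].
Qed.

Lemma minimal_invariant_exists : exists sigma : probability TB R,
  invariant_on sigma /\ forall A : set TB,
    measurable A -> A `<=` B -> sigma A = (mu A / mu B)%E.
Proof.
have BfinR := mu_measurable_fin mB.
(* [dirac point] is the default for total mass zero or infinite, which [muB] and [mu_fin]
   exclude. *)
pose sigma := mnormalize (mrestr mu mB) (dirac point).
have sE (A : set TB) : measurable A -> A `<=` B -> sigma A = (mu A / mu B)%E.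
  move=> mA AB; rewrite /sigma /mnormalize /= /mrestr setTI.
  rewrite gt_eqF // lt_eqF ?ltey_eq ?BfinR //= (setIidl AB).
  congr (_ * _)%E; rewrite -[X in (X^-1)%E](fineK BfinR) inver.
  by rewrite fine_eq0 // gt_eqF.
exists sigma; split; last exact: sE.
split; first by transitivity (sigma B) => //; rewrite sE // divee // gt_eqF.
move=> A mA AB; transitivity (sigma (B `&` phi @^-1` A)) => //.
transitivity (sigma A) => //.
have m1 : measurable (B `&` phi @^-1` A : set TB).
  by apply: measurableI => //; exact: measurable_preimage.
by rewrite (sE _ m1 (@subIsetl _ _ _)) (sE _ mA AB) isometry_preserves_minimal.
Qed.

End ball_frame_theory.

(** * Chart balls as a base of the topology of P^1(Q_2) *)

Lemma affine_coordE (F : fieldType) (eta beta x : F) :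
  eta^-1 * x + - beta / eta = (x - beta) / eta.
Proof. by rewrite mulrBl mulrC mulNr. Qed.

Lemma inv_diff (F : fieldType) (x y : F) : x != 0 -> y != 0 ->
  x^-1 - y^-1 = (y - x) * (x^-1 * y^-1).
Proof. by move=> x0 y0; field; rewrite x0 y0. Qed.

Lemma inv_sub_inv (F : fieldType) (x y : F) : x != 0 -> y != 0 ->
  y - x^-1 = (x - y^-1) * (x^-1 * y).
Proof. by move=> x0 y0; field; rewrite x0 y0. Qed.

Section projective_line.
Variables (beta eta : Q2) (eta0 : eta != 0).
Local Notation dQ2 := dyadic_absQ2.
Local Notation zc x := ((x - beta) / eta).
Local Notation sideP := (side absQ2 beta eta).
Local Notation coordP := (coord absQ2 beta eta).
Local Notation ballP := (chart_ball absQ2 beta eta).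

Definition inner_pt (z : Q2) : PQ2 := Some (eta * z + beta).
Definition outer_pt (y : Q2) : PQ2 := if y == 0 then None else Some (eta * y^-1 + beta).

Let zcK (z : Q2) : zc (eta * z + beta) = z.
Proof. by rewrite addrK [eta * z]mulrC mulfK. Qed.

Let etaK (x : Q2) : eta * zc x + beta = x.
Proof. by rewrite mulrC divfK // subrK. Qed.

Lemma inner_ptP z : Z2 z -> sideP (inner_pt z) = true /\ coordP (inner_pt z) = 2%:R * z.
Proof. by move=> zZ; rewrite /side /coord /inner_pt zcK; split; [exact:
  zZ|rewrite ifT]. Qed.

Lemma outer_ptP y : absQ2 y <= 2%:R^-1 ->
  sideP (outer_pt y) = false /\ coordP (outer_pt y) = y.
Proof.
rewrite /outer_pt; have [->//|y0] := eqVneq y 0.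
move=> y2; rewrite /side /coord zcK.
have n1 : absQ2 y^-1 <= 1 = false.
  apply/negbTE; rewrite -ltNge (dabsV dQ2) invf_gt1 ?absQ2_gt0 //.
  by apply: le_lt_trans y2 _; rewrite invf_lt1.
by rewrite n1 invrK.
Qed.

Lemma inner_ptK p : sideP p -> exists2 z, Z2 z & p = inner_pt z.
Proof. by case: p => //= x xZ; exists (zc x) => //; rewrite /inner_pt etaK. Qed.

Lemma outer_ptK p : ~~ sideP p -> exists2 y, absQ2 y <= 2%:R^-1 & p = outer_pt y.
Proof.
case: p => [x|_] /=; last by exists 0; rewrite ?absQ2_0 ?invr_ge0 // /outer_pt eqxx.
rewrite -ltNge => z1; have z2 := dabs_gt1 dQ2 z1.
have z0 : zc x != 0 by rewrite -absQ2_gt0 (lt_trans _ z1).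
exists (zc x)^-1; first by rewrite (dabsV dQ2) lef_pV2 // posrE (lt_le_trans _ z2).
by rewrite /outer_pt invr_eq0 (negbTE z0) invrK etaK.
Qed.

Lemma chart_ball_inner n z z' : Z2 z -> Z2 z' ->
  ballP n (inner_pt z) (inner_pt z') = (absQ2 (z - z') <= 2%:R^-1 ^+ n).
Proof.
move=> /inner_ptP[s1 c1] /inner_ptP[s2 c2]; rewrite /chart_ball s1 s2 c1 c2 eqxx /=.
by rewrite -mulrBr absQ2M absQ2_2 exprS ler_pM2l.
Qed.

Lemma chart_ball_outer n y y' : absQ2 y <= 2%:R^-1 -> absQ2 y' <= 2%:R^-1 ->
  ballP n (outer_pt y) (outer_pt y') = (absQ2 (y - y') <= 2%:R^-1 ^+ n.+1).
Proof.
by move=> /outer_ptP[s1 c1] /outer_ptP[s2 c2]; rewrite /chart_ball s1 s2 c1 c2 eqxx.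
Qed.

Lemma chart_ball_mixed n z y : Z2 z -> absQ2 y <= 2%:R^-1 ->
  ballP n (inner_pt z) (outer_pt y) = false.
Proof. by move=> /inner_ptP[s1 c1] /outer_ptP[s2 c2]; rewrite /chart_ball s1 s2. Qed.

(** Integers represent Z_2 modulo 2^n, and 2 Z_2 modulo 2^(n+1). Odd integers in the second list lie
    outside 2 Z_2 and only add further points. *)
Definition chart_net (n : nat) : seq PQ2 :=
  [seq inner_pt k%:R | k <- iota 0 (2 ^ n)] ++
  [seq outer_pt k%:R | k <- iota 0 (2 ^ n.+1)].

Let natZ2 k : Z2 (k%:R : Q2).
Proof. by rewrite /Z2 /= absQ2_nat -[k%:R]/((k%:Z)%:~R) abs2_int. Qed.

Lemma chart_netP n p : exists2 q, q \in chart_net n & ballP n q p.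
Proof.
have [/inner_ptK[z zZ ->]|/outer_ptK[y y2 ->]] := boolP (sideP p).
  have [k kn kz] := closed_ballQ2_nat n zZ; exists (inner_pt k%:R).
    by rewrite mem_cat; apply/orP; left; apply/mapP; exists k => //; rewrite mem_iota.
  by rewrite chart_ball_inner.
have yZ : Z2 y by apply: le_trans y2 _; rewrite invf_le1.
have [k kn ky] := closed_ballQ2_nat n.+1 yZ; exists (outer_pt k%:R).
  by rewrite mem_cat; apply/orP; right; apply/mapP; exists k => //; rewrite mem_iota.
rewrite chart_ball_outer //.
have -> : (k%:R : Q2) = (k%:R - y) + y by rewrite subrK.
apply: (dabs_le dQ2) => //; apply: le_trans ky _.
by rewrite exprS ler_piMr ?invr_ge0 // exprn_ile1 // ?invr_ge0 // invf_le1.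
Qed.

Lemma affine_continuous (u v : Q2) : continuous (fun z : Q2 => u * z + v).
Proof.
move=> z U /nbhs_closed_ballQ2P[n nU].
suff : nbhs z ((fun z : Q2 => u * z + v) @^-1` U) by [].
have [u0|u0] := eqVneq u 0.
  by apply: filterS filterT => y _; apply: nU;
    rewrite u0 !mul0r /closed_ballQ2 /= subrr absQ2_0 exprn_ge0 // invr_ge0.
have [|m mn] := @half_exp_lt (2%:R^-1 ^+ n / absQ2 u).
  by rewrite divr_gt0 ?absQ2_gt0 // exprn_gt0 // invr_gt0.
apply: filterS (nbhs_closed_ballQ2 z m) => y zy; apply: nU; rewrite /closed_ballQ2 /=.
have -> : u * z + v - (u * y + v) = u * (z - y) by ring.
rewrite absQ2M mulrC -ler_pdivlMr ?absQ2_gt0 //.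
by apply: le_trans zy _; exact: ltW.
Qed.

(** Compact discs exhausting Q_2; every compact set lies in one of them, so their complements form a
    base of neighbourhoods of infinity. *)
Let K m : set Q2 := [set x | absQ2 (zc x) <= 2%:R ^+ m].

Let compactK m : compact (K m).
Proof.
have two : (2%:R : Q2) ^+ m != 0 by apply: expf_neq0; exact: Q2_two_neq0.
have -> : K m = (fun z : Q2 => eta * (2%:R ^+ m)^-1 * z + beta) @` Z2.
  apply/seteqP; split => [x xK|_ [z zZ <-]].
    exists (2%:R ^+ m * zc x); last by rewrite -mulrA mulKf // etaK.
    rewrite /Z2 /= absQ2M absQ2_two_exp exprVn mulrC ler_pdivrMr ?exprn_gt0 //.
    by rewrite mul1r.
  rewrite /K /= -mulrA zcK absQ2M (dabsV dQ2) absQ2_two_exp -exprVn invrK.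
  by rewrite ler_piMr // exprn_ge0.
apply: continuous_compact; last exact: compact_Z2.
by apply: continuous_subspaceT => z; exact: affine_continuous.
Qed.

Let closedK m : closed (K m).
Proof. exact: (compact_closed (@metric_hausdorff rat Q2) (@compactK m)). Qed.

Let compact_bounded_zc (A : set Q2) : compact A -> exists m, A `<=` K m.
Proof.
move=> /compact_near_coveringP cA.
have : \forall m \near \oo, A `<=` (fun x => K m x).
  apply: (cA _ \oo (fun m x => K m x)) => x _.
  pose M := Num.bound (absQ2 (zc x) + absQ2 eta^-1).
  have Mb : absQ2 (zc x) + absQ2 eta^-1 <= 2%:R ^+ M by apply/ltW/upper_nthrootP.
  exists (closed_ballQ2 x 0, [set m | (M <= m)%N]).
    by split; [exact: nbhs_closed_ballQ2|exists M].
  move=> [y m] [/= xy Mm]; rewrite /K /=.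
  have -> : zc y = zc x + (y - x) * eta^-1 by rewrite -mulrDl; congr (_ * _); ring.
  apply: le_trans (_ : 2%:R ^+ M <= _); last by rewrite ler_eXn2l.
  apply: le_trans Mb; apply: (dabs_le dQ2); first by rewrite lerDl (dabs_ge0 dQ2).
  rewrite absQ2M; apply: le_trans (_ : absQ2 eta^-1 <= _);
    last by rewrite lerDr (dabs_ge0 dQ2).
  by rewrite ler_piMl ?(dabs_ge0 dQ2) // (dabsB dQ2) -(expr0 (2%:R^-1 : rat)).
by move=> [m _ mA]; exists m; apply: mA => /=.
Qed.

Let ball_nbhs n (p : PQ2) : nbhs p ([set q | ballP n p q] : set PQ2).
Proof.
have [/inner_ptK[z zZ ->]|/outer_ptK[y y2 ->]] := boolP (sideP p).
  have c : nbhs (eta * z + beta) [set x | closed_ballQ2 z n (eta^-1 * x + (- beta / eta))].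
    apply: (affine_continuous (u := eta^-1) (v := - beta / eta)).
    rewrite affine_coordE zcK.
    exact: nbhs_closed_ballQ2.
  apply: filterS c => x /=.
  rewrite affine_coordE.
  move=> zx; have xZ : Z2 (zc x).
    rewrite Z2_closed_ball; apply: closed_ballQ2_trans (closed_ballQ2_le (leq0n n) zx).
    by rewrite -Z2_closed_ball.
  have -> : Some x = inner_pt (zc x) by rewrite /inner_pt etaK.
  by rewrite chart_ball_inner.
have [y0|y0] := eqVneq y 0.
  rewrite y0 {1}/outer_pt eqxx; exists (K n.+1); first by split; [exact: compactK|exact:
    closedK].
  move=> q [[x /= xK <-]|->]; last by rewrite /outer_pt eqxx; exact:
    (chart_ball_refl dQ2).
  have zx : 2%:R ^+ n.+1 < absQ2 (zc x) by rewrite ltNge; apply/negP.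
  have zx1 : absQ2 (zc x)^-1 <= 2%:R^-1 ^+ n.+1.
    by rewrite (dabsV dQ2) exprVn lef_pV2 ?posrE ?exprn_gt0 ?ltW // (lt_trans _ zx)
      ?exprn_gt0.
  have z0 : zc x != 0 by rewrite -absQ2_gt0 (lt_trans _ zx) ?exprn_gt0.
  have -> : Some x = outer_pt (zc x)^-1.
    by rewrite /outer_pt invr_eq0 (negbTE z0) invrK etaK.
  rewrite chart_ball_outer ?sub0r ?absQ2N ?absQ2_0 ?invr_ge0 //.
  by apply: le_trans zx1 _; rewrite exprS ler_piMr ?invr_ge0 // exprn_ile1 //
    ?invr_ge0 // invf_le1.
rewrite {1}/outer_pt (negbTE y0).
have yV : 2%:R <= absQ2 y^-1 by rewrite (dabsV dQ2) -[leLHS]invrK lef_pV2 ?posrE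
  ?absQ2_gt0 ?invr_gt0.
have c : nbhs (eta * y^-1 + beta) [set x | closed_ballQ2 y^-1 n.+1 (eta^-1 * x + (- beta / eta))].
  apply: (affine_continuous (u := eta^-1) (v := - beta / eta)).
  rewrite affine_coordE zcK.
  exact: nbhs_closed_ballQ2.
apply: filterS c => x /=.
rewrite affine_coordE.
move=> zx; have small : absQ2 (y^-1 - zc x) < absQ2 y^-1.
  apply: le_lt_trans zx _; apply: lt_le_trans yV.
  by apply: le_lt_trans (_ : 1 < _) => //; rewrite exprn_ile1 // ?invr_ge0 // invf_le1.
have zE : absQ2 (zc x) = absQ2 y^-1.
  have -> : zc x = y^-1 + - (y^-1 - zc x) by rewrite subKr.
  by rewrite (dabs_dom dQ2) // (dabsN dQ2).
have z0 : zc x != 0 by rewrite -absQ2_gt0 zE (lt_le_trans _ yV).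
have -> : Some x = outer_pt (zc x)^-1.
  by rewrite /outer_pt invr_eq0 (negbTE z0) invrK etaK.
rewrite chart_ball_outer //; last by rewrite (dabsV dQ2) zE (dabsV dQ2) invrK.
(* Since [|zc x| = 1 / |y|], inversion multiplies the distance by [|y| ^ 2], which is at most 1. *)
rewrite (inv_sub_inv z0 y0) absQ2M (dabsB dQ2); apply: le_trans _ zx;
  rewrite ler_piMr ?(dabs_ge0 dQ2) //.
rewrite absQ2M (dabsV dQ2) zE (dabsV dQ2) invrK.
by rewrite -expr2 exprn_ile1 ?(dabs_ge0 dQ2) //; apply: le_trans y2 _; rewrite invf_le1.
Qed.

Lemma chart_ball_open n (p : PQ2) : open ([set q | ballP n p q] : set PQ2).
Proof.
rewrite openE => q pq; rewrite /interior; apply: filterS (ball_nbhs n q) => r.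
exact: (chart_ball_trans dQ2).
Qed.

Lemma chart_ball_base (U : set PQ2) (p : PQ2) : open U -> U p ->
  exists n, [set q | ballP n p q] `<=` U.
Proof.
move=> oU Up; have : nbhs p U by apply: open_nbhs_nbhs.
have [/inner_ptK[z zZ pE]|/outer_ptK[y y2 pE]] := boolP (sideP p).
  rewrite pE => /(affine_continuous (u := eta) (v := beta)) zU.
  have [n nU] := nbhs_closed_ballQ2P (zU : nbhs z _); exists n => q /=.
  have [/inner_ptK[z' zZ' ->]|/outer_ptK[y' y2' ->]] := boolP (sideP q).
    by rewrite chart_ball_inner // => /nU.
  by rewrite chart_ball_mixed.
have [y0|y0] := eqVneq y 0.
  rewrite pE y0 {1}/outer_pt eqxx => -[A [cA _] AU]; have [m mA] := compact_bounded_zc cA.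
  exists m => q /=; have [/inner_ptK[z zZ ->]|/outer_ptK[y' y2' ->]] := boolP (sideP q).
    by rewrite (chart_ball_sym dQ2) chart_ball_mixed // absQ2_0 invr_ge0.
  rewrite chart_ball_outer // ?absQ2_0 ?invr_ge0 // sub0r absQ2N => ym; apply: AU.
  have [y0'|y0'] := eqVneq y' 0; first by right; rewrite /= /outer_pt y0' eqxx.
  rewrite /outer_pt (negbTE y0').
  left; exists (eta * y'^-1 + beta) => // /mA; rewrite /K /= zcK (dabsV dQ2); apply/negP.
  rewrite -ltNge -[ltLHS]invrK ltf_pV2 ?posrE ?absQ2_gt0 ?invr_gt0 ?exprn_gt0 //.
  by apply: le_lt_trans ym _; rewrite exprS exprVn gtr_pMl ?invr_gt0
    ?exprn_gt0 // invf_lt1.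
rewrite pE {1}/outer_pt (negbTE y0).
move=> /(affine_continuous (u := eta) (v := beta)) zU.
have [n nU] := nbhs_closed_ballQ2P (zU : nbhs y^-1 _).
have yp : 0 < absQ2 y by rewrite absQ2_gt0.
have hn (k : nat) : 0 < (2%:R^-1 : rat) ^+ k by rewrite exprn_gt0 // invr_gt0.
(* Passing from [y] back to [1 / y] expands distances by [|y| ^ -2], so the radius is reduced by
   [|y| ^ 2]. *)
have [m mn0] := half_exp_lt (mulr_gt0 (mulr_gt0 yp yp) (hn n)).
have mn : 2%:R^-1 ^+ m.+1 < absQ2 y * absQ2 y * 2%:R^-1 ^+ n.
  by apply: lt_trans mn0; rewrite exprS gtr_pMl // invf_lt1.
have my : 2%:R^-1 ^+ m.+1 < absQ2 y.
  apply: lt_le_trans mn _; rewrite -mulrA ler_piMr ?(dabs_ge0 dQ2) //.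
  by rewrite mulr_ile1 ?(dabs_ge0 dQ2) ?exprn_ge0 ?exprn_ile1 ?invr_ge0
    ?invf_le1 // (le_trans y2) // invf_le1.
exists m => q /=; have [/inner_ptK[z zZ ->]|/outer_ptK[y' y2' ->]] := boolP (sideP q).
  by rewrite (chart_ball_sym dQ2) chart_ball_mixed.
rewrite chart_ball_outer // => yy.
have yE : absQ2 y' = absQ2 y.
  have -> : y' = y + - (y - y') by rewrite subKr.
  by rewrite (dabs_dom dQ2) // (dabsN dQ2) (le_lt_trans yy).
have y0' : y' != 0 by rewrite -absQ2_gt0 yE.
rewrite /outer_pt (negbTE y0'); apply: nU; rewrite /closed_ballQ2 /=.
rewrite inv_diff // !absQ2M !(dabsV dQ2) yE (dabsB dQ2).
rewrite -ler_pdivlMr ?mulr_gt0 ?invr_gt0 // invfM !invrK mulrC.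
by apply: le_trans yy (ltW mn).
Qed.

End projective_line.

(** * The image of [mubar] under the chart *)

Section chart_measure.
Variables (beta eta : Q2) (eta0 : eta != 0).
Variables (R : realType) (mu0 : probability Q2_borel R) (hmu0 : haar_Z2 mu0).
Local Notation dQ2 := dyadic_absQ2.
Local Notation ballP := (chart_ball absQ2 beta eta : nat -> PQ2 -> PQ2 -> bool).
Local Notation inner := (inner_pt beta eta).
Local Notation outer := (outer_pt beta eta).

Lemma chart_ball_frame : ball_frame ballP (chart_net beta eta).
Proof.
split.
- by move=> n p; exact: (chart_ball_refl dQ2).
- by move=> n p q; exact: (chart_ball_sym dQ2).
- by move=> n q p r; exact: (chart_ball_trans dQ2).
- by move=> n m p q; exact: chart_ball_le.
- split; [exact: chart_ball_open|exact: chart_ball_base|exact: chart_netP].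
Qed.

(** A pushforward needs a total measurable map. The value [None] off [D] carries no mass once the
    measure is restricted to [D]. *)
Let measurable_patch (D : set Q2_borel) (f : Q2 -> PQ2) : measurable D ->
  (forall n p, measurable (D `&` f @^-1` [set q | ballP n p q] : set Q2_borel)) ->
  measurable_fun setT ((fun z => if z \in D then f z else None) : Q2_borel -> PQ2_borel).
Proof.
move=> mD mf; apply:
  (measurability (ball_sets (T := PQ2) ballP) (ball_sets_gen chart_ball_frame)).
move=> _ [_ [->|[n [p ->]]] <-]; first by rewrite preimage_set0 setI0; exact: measurable0.
rewrite setTI.
have -> : (fun z => if z \in D then f z else None) @^-1` [set q | ballP n p q] =
  (D `&` f @^-1` [set q | ballP n p q]) `|` (~` D `&` [set _ | ballP n p None]).
  apply/seteqP; split => z /=.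
    case: ifPn; rewrite ?inE ?notin_setE => h1 h2; by [left|right].
  by case=> -[h1 h2]; [rewrite mem_set|rewrite memNset].
apply: measurableU => //; apply: measurableI; first exact: measurableC.
have [h|h] := boolP (ballP n p None).
  by rewrite [X in measurable X](_ : _ = setT) //; apply/seteqP; split.
by rewrite [X in measurable X](_ : _ = set0) //; apply/seteqP; split.
Qed.

Let half_ball := closed_ballQ2 0 1.

Let half_ballE y : half_ball y <-> absQ2 y <= 2%:R^-1.
Proof. by rewrite /half_ball /closed_ballQ2 /= sub0r absQ2N expr1. Qed.

Let inner_preimage n z : Z2 z ->
  Z2 `&` inner @^-1` [set q | ballP n (inner z) q] = closed_ballQ2 z n.
Proof.
move=> zZ; apply/seteqP; split => [z' [zZ']|z' zz'] /=.
  by rewrite chart_ball_inner.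
have zZ' : Z2 z'.
  rewrite Z2_closed_ball; apply: closed_ballQ2_trans (closed_ballQ2_le (leq0n n) zz').
  by rewrite -Z2_closed_ball.
by rewrite chart_ball_inner.
Qed.

Let inner_preimage0 n y : absQ2 y <= 2%:R^-1 ->
  Z2 `&` inner @^-1` [set q | ballP n (outer y) q] = set0.
Proof.
move=> y2; apply/seteqP; split => // z [zZ] /=.
by rewrite (chart_ball_sym dQ2) chart_ball_mixed.
Qed.

Let outer_preimage n y : absQ2 y <= 2%:R^-1 ->
  half_ball `&` outer @^-1` [set q | ballP n (outer y) q] = closed_ballQ2 y n.+1.
Proof.
move=> y2; apply/seteqP; split => [y' [/half_ballE y2']|y' yy'] /=.
  by rewrite chart_ball_outer.
have y2' : half_ball y'.
  apply: closed_ballQ2_trans (closed_ballQ2_le (_ : 1 <= n.+1)%N yy') => //.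
  exact/half_ballE.
by split => //; rewrite chart_ball_outer //; apply/half_ballE.
Qed.

Let outer_preimage0 n z : Z2 z ->
  half_ball `&` outer @^-1` [set q | ballP n (inner z) q] = set0.
Proof.
move=> zZ; apply/seteqP; split => // y [/half_ballE y2] /=.
by rewrite chart_ball_mixed.
Qed.

Let point_cases (p : PQ2) :
  (exists2 z, Z2 z & p = inner z) \/ (exists2 y, absQ2 y <= 2%:R^-1 & p = outer y).
Proof.
have [/(inner_ptK eta0)|/(outer_ptK eta0)] := boolP (side absQ2 beta eta p).
  by left.
by right.
Qed.

Let mZ2 : measurable (Z2 : set Q2_borel).
Proof. by rewrite Z2_closed_ball; exact: measurable_closed_ballQ2. Qed.

Let mhalf : measurable (half_ball : set Q2_borel).
Proof. exact: measurable_closed_ballQ2. Qed.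

Let inner_map : Q2_borel -> PQ2_borel := fun z => if z \in Z2 then inner z else None.
Let outer_map : Q2_borel -> PQ2_borel := fun z =>
  if z \in half_ball then outer z else None.

Let measurable_inner : measurable_fun setT inner_map.
Proof.
apply: measurable_patch => // n p.
have [[z zZ ->]|[y y2 ->]] := point_cases p.
  by rewrite inner_preimage //; exact: measurable_closed_ballQ2.
by rewrite inner_preimage0.
Qed.

Let measurable_outer : measurable_fun setT outer_map.
Proof.
apply: measurable_patch => // n p.
have [[z zZ ->]|[y y2 ->]] := point_cases p.
  by rewrite outer_preimage0.
by rewrite outer_preimage //; exact: measurable_closed_ballQ2.
Qed.

(** A ball of level [n] has mass 1/2 * 2^-n on the side of Z_2 and 2^-(n+1) on the other side, so
    both sides agree. *)
Lemma chart_measure_exists : exists mu : {measure set PQ2_borel -> \bar R},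
  (forall A : set PQ2, mu A = (2^-1%:E * mu0 (Z2 `&` inner @^-1` A)
      + mu0 (half_ball `&` outer @^-1` A))%E) /\
  forall n p, mu [set q | ballP n p q] = (2%:R^-1 ^+ n.+1)%:E.
Proof.
have half0 : 0 <= 2^-1 :> R by rewrite invr_ge0.
pose half : {nonneg R} := NngNum half0.
unshelve refine (let mu : {measure set PQ2_borel -> \bar R} :=
  measure_add (mscale half (pushforward (mrestr mu0 mZ2) inner_map))
    (pushforward (mrestr mu0 mhalf) outer_map) in _).
- exact: measurable_inner.
- exact: measurable_outer.
have muE A : mu A = (2^-1%:E * mu0 (Z2 `&` inner @^-1` A)
      + mu0 (half_ball `&` outer @^-1` A))%E.
  transitivity ((2^-1)%:E * mu0 (inner_map @^-1` A `&` Z2) +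
      mu0 (outer_map @^-1` A `&` half_ball))%E.
    exact: measure_addE.
  congr (_ * mu0 _ + mu0 _)%E; apply/seteqP; split => z /=.
  - by rewrite /inner_map => -[h zZ]; rewrite mem_set in h.
  - by rewrite /inner_map => -[zZ h]; rewrite mem_set.
  - by rewrite /outer_map => -[h zZ]; rewrite mem_set in h.
  - by rewrite /outer_map => -[zZ h]; rewrite mem_set.
exists mu; split => // n p; rewrite muE.
have [[z zZ ->]|[y y2 ->]] := point_cases p.
  rewrite inner_preimage // outer_preimage0 // measure0 adde0.
  by rewrite (haar_Z2_ball _ hmu0 zZ) exprS EFinM.
rewrite inner_preimage0 // outer_preimage // measure0 mule0 add0e.
apply: (haar_Z2_ball _ hmu0); apply: le_trans y2 _; rewrite invf_le1 //.
Qed.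

End chart_measure.

(** * Surjectivity, eigenvalues and square roots *)

Section mobius_generic.
Variable F : fieldType.
Implicit Types a b c d : F.

Lemma mob_surj a b c d (p : option F) : a * d - b * c != 0 ->
  exists q, mob a b c d q = p.
Proof.
move=> det; have dneq : d * a - - b * - c != 0 by rewrite mulrNN mulrC.
have proj (X Y : F) : (X != 0) || (Y != 0) ->
    exists q, mob a b c d q = proj_pt X Y.
  (* The preimage is obtained from the adjugate matrix. *)
  move=> XY; exists (proj_pt (d * X - b * Y) (- c * X + a * Y)).
  have E1 : a * (d * X - b * Y) + b * (- c * X + a * Y) = (a * d - b * c) * X by ring.
  have E2 : c * (d * X - b * Y) + d * (- c * X + a * Y) = (a * d - b * c) * Y by ring.
  rewrite mob_pt ?E1 ?E2 //.
    rewrite /proj_pt mulf_eq0 (negbTE det) /=; case: eqP => // /eqP Y0.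
    by congr Some; field; rewrite Y0 det.
  apply: contraLR XY; rewrite !negb_or !negbK => /andP[/eqP e1 /eqP e2].
  move: E1 E2; rewrite e1 e2 !mulr0 addr0 => /esym/eqP + /esym/eqP.
  by rewrite !mulf_eq0 (negbTE det) /= => -> ->.
case: p => [x|].
  have [|q qE] := proj x 1; first by rewrite oner_eq0 orbT.
  by exists q; rewrite qE /proj_pt oner_eq0 divr1.
have [|q qE] := proj 1 0; first by rewrite oner_eq0.
by exists q; rewrite qE /proj_pt eqxx.
Qed.

(** A root [x] of the characteristic polynomial obeys the same quadratic relation as [M], hence the
    same expansion of its powers. *)
Lemma mob_pow_eigen (L : fieldType) (f : {rmorphism F -> L}) a b c d (x : L) k :
  x ^+ 2 = f (a + d) * x - f (a * d - b * c) ->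
  x ^+ k = f (mob_pow a b c d k).1 * x + f (mob_pow a b c d k).2.
Proof.
move=> x2; elim: k => [|k IH] /=; first by rewrite rmorph0 mul0r add0r rmorph1.
move: IH; case: (mob_pow a b c d k) => u w /= IH.
rewrite exprSr IH mulrDl -mulrA -expr2 x2 rmorphD rmorphN !rmorphM /=.
by ring.
Qed.

(** [lambda] is the ratio of the two eigenvalues of [M]. If u_k = 0, both have the same k-th power
    w_k, so [lambda ^ k = 1]. *)
Lemma mob_pow_neq0 (L : fieldType) (f : {rmorphism F -> L}) a b c d (s lambda : L) :
  (2%:R : F) != 0 -> a * d - b * c != 0 ->
  s ^+ 2 = f ((d - a) ^+ 2 + 4%:R * b * c) ->
  lambda = (f (a + d) + s) / (f (a + d) - s) ->
  (forall n, (0 < n)%N -> lambda ^+ n <> 1) ->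
  forall k, (0 < k)%N -> (mob_pow a b c d k).1 != 0.
Proof.
move=> two det s2 lE lroot k k0; apply/negP => /eqP uk; apply: (lroot k k0).
have two' : (2%:R : L) != 0 by rewrite -(rmorph_nat f) fmorph_eq0.
have four' : (4%:R : L) != 0 by rewrite -[4%N]/(2 * 2)%N natrM mulf_neq0.
have s2' : s ^+ 2 = (f d - f a) ^+ 2 + 4%:R * f b * f c.
  by rewrite s2 rmorphD rmorphXn rmorphB !rmorphM rmorph_nat.
have eig r : r ^+ 2 = s ^+ 2 -> ((f (a + d) + r) / 2%:R) ^+ k = f (mob_pow a b c d k).2.
  move=> r2; rewrite (@mob_pow_eigen _ f a b c d) ?uk ?rmorph0 ?mul0r ?add0r //.
  rewrite rmorphB !rmorphD !rmorphM /=.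
  apply: (mulfI four').
  have -> : 4%:R * ((f a + f d + r) / 2%:R) ^+ 2 =
      (f a + f d) ^+ 2 + 2%:R * (f a + f d) * r + r ^+ 2.
    by field.
  by rewrite r2 s2'; field.
have prod : (f (a + d) + s) * (f (a + d) - s) = 4%:R * f (a * d - b * c).
  by rewrite mulrC -subr_sqr s2' rmorphB !rmorphD !rmorphM /=; ring.
have : (f (a + d) + s) * (f (a + d) - s) != 0 by rewrite prod mulf_neq0 // fmorph_eq0.
rewrite mulf_eq0 negb_or => /andP[p1 p2].
have -> : lambda = (f (a + d) + s) / 2%:R / ((f (a + d) - s) / 2%:R).
  by rewrite lE invf_div mulrA divfK.
rewrite expr_div_n (eig s) // (eig (- s)) ?sqrrN // divff //.
by rewrite -(eig s) // expf_neq0 // mulf_neq0 // invr_eq0.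
Qed.

End mobius_generic.

Section quadratic.
Variables (F : fieldType) (L : fieldExtType F).

Lemma Fadjoin_sqrt_decomp (i : F) (t x : L) : t ^+ 2 = i%:A -> x \in <<1; t>>%VS ->
  exists u v : F, x = u%:A + v%:A * t.
Proof.
move=> t2 /Fadjoin_polyP[_ /polyOver1P[p ->] ->].
elim/poly_ind: p => [|p k [u [v IH]]].
  by exists 0, 0; rewrite rmorph0 horner0 scale0r mul0r addr0.
exists (v * i + k), u.
rewrite rmorphD rmorphM /= map_polyX map_polyC hornerMXaddC IH.
have t2' : t ^+ 2 = in_alg L i by [].
rewrite -[LHS]/((in_alg L u + in_alg L v * t) * t + in_alg L k).
rewrite -[RHS]/(in_alg L (v * i + k) + in_alg L u * t).
have E1 : in_alg L (v * i + k) = in_alg L v * t ^+ 2 + in_alg L k.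
  by rewrite t2' rmorphD rmorphM.
by rewrite E1; ring.
Qed.

(** Squaring [s = u + v t] gives [2 u v t = Delta - u ^ 2 - v ^ 2 i]. If [u] and [v] were nonzero,
    [t] and then [s] would lie in the base field. *)
Lemma sqrt_mul (Delta i : F) (s t : L) : (2%:R : F) != 0 ->
  s ^+ 2 = Delta%:A -> t ^+ 2 = i%:A -> s \notin 1%VS -> <<1; s>>%VS = <<1; t>>%VS ->
  exists q : F, s = q%:A * t /\ Delta = q ^+ 2 * i.
Proof.
move=> two s2 t2 sn st.
have [u [v sE]] : exists u v : F, s = u%:A + v%:A * t.
  by apply: (Fadjoin_sqrt_decomp t2); rewrite -st memv_adjoin.
have inA (k : F) : (k%:A : L) \in 1%VS by apply/vlineP; exists k.
have v0 : v != 0.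
  by apply: contraNneq sn => v0; rewrite sE v0 scale0r mul0r addr0.
have u0 : u = 0.
  apply/eqP; apply: contraNT sn => u0; rewrite sE.
  have uv0 : 2%:R * u * v != 0 by rewrite !mulf_neq0.
  have E : in_alg L (2%:R * u * v) * t = in_alg L (Delta - u ^+ 2 - v ^+ 2 * i).
    have s2' : in_alg L Delta = (in_alg L u + in_alg L v * t) ^+ 2 by rewrite /= -sE s2.
    have t2' : t ^+ 2 = in_alg L i by [].
    have -> : in_alg L (Delta - u ^+ 2 - v ^+ 2 * i) =
        in_alg L Delta - in_alg L u ^+ 2 - in_alg L v ^+ 2 * in_alg L i.
      by rewrite !rmorphB (rmorphM _ (v ^+ 2)) !rmorphXn.
    have -> : in_alg L (2%:R * u * v) = 2%:R * in_alg L u * in_alg L v.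
      by rewrite !rmorphM rmorph_nat.
    by rewrite s2' -t2'; ring.
  have -> : t = in_alg L ((Delta - u ^+ 2 - v ^+ 2 * i) / (2%:R * u * v)).
    have n0 : in_alg L (2%:R * u * v) != 0 by rewrite fmorph_eq0.
    by apply: (mulfI n0); rewrite E -rmorphM mulrCA divff // mulr1.
  by rewrite -[_ + _]/(in_alg L u + in_alg L v * in_alg L _) -rmorphM -rmorphD; exact:
    inA.
exists v; rewrite sE u0 scale0r add0r; split => //.
apply: (fmorph_inj (in_alg L));
  rewrite rmorphM rmorphXn /= -s2 sE u0 scale0r add0r exprMn.
by rewrite t2.
Qed.

End quadratic.

Lemma ln_exp2 (R : realType) (m : int) : ln (2%:R ^ m : R) = m%:~R * ln 2%:R.
Proof.
have two : (2%:R : R) \is Num.pos by rewrite posrE.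
case: m => n; first by rewrite -exprnP lnXn // mulr_natl.
by rewrite NegzE -exprnN lnV ?posrE ?exprn_gt0 // lnXn // mulrNz mulNr mulr_natl.
Qed.

Lemma ratr_exp2 (R : realType) (m : int) : ratr (2%:R ^ m : rat) = 2%:R ^ m :> R.
Proof.
transitivity ((ratr 2%:R : R) ^ m); last by rewrite ratr_nat.
exact: (fmorphXz (ratr : {rmorphism rat -> R})).
Qed.

Lemma floor_valuation2 (R : realType) (L : Type) (absL : L -> R) (s : L) (m : int) :
  absL s = 2%:R ^ m -> Num.floor (valuation2 absL s) = - m.
Proof.
move=> E; rewrite /valuation2 E ln_exp2 mulfK; last first.
  by rewrite gt_eqF // ln_gt0 // ltr1n.
by rewrite -rmorphN intrKfloor.
Qed.

Section unit_squares.
Variables (F : fieldType) (N : F -> rat) (hN : dyadic_abs N).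

(** Both factors of [u ^ 2 - 1 = (u - 1) (u + 1)] are divisible by 2. *)
Lemma dabs_unit_sqr (u : F) : N u = 1 ->
  exists2 t, u ^+ 2 = 1 + t & N t <= 4%:R^-1.
Proof.
move=> Nu; exists (u ^+ 2 - 1); first by ring.
have u1 : N (u - 1) <= 2%:R^-1.
  by have [|h|//] := dabs_residue hN (x := u); [rewrite Nu|move: h; rewrite Nu].
have -> : u ^+ 2 - 1 = (u - 1) * ((u - 1) + 2%:R) by ring.
have u2 : N (u - 1 + 2%:R) <= 2%:R^-1 by apply: (dabs_le hN) => //; rewrite dabs2.
rewrite (dabsM hN); have := dabs_ge0 hN (u - 1); have := dabs_ge0 hN (u - 1 + 2%:R).
have -> : (4%:R^-1 : rat) = 2%:R^-1 * 2%:R^-1 by [].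
by move=> h1 h2; apply: ler_pM.
Qed.

(** Both values of [i] are 3 modulo 4 and [u ^ 2] is 1 modulo 4, so [1 - i u ^ 2] is 2 modulo 4. *)
Lemma dabs_one_sub (i u : F) : i = -1 \/ i = 3%:R -> N u = 1 ->
  N (1 - i * u ^+ 2) = 2%:R^-1.
Proof.
move=> hi /dabs_unit_sqr[t -> t4].
have N3 : N 3%:R <= 1.
  rewrite -[3%N]/(1 + 2)%N natrD; apply: (dabs_le hN); rewrite ?(dabs1 hN) ?(dabs2 hN) //.
case: hi => ->.
  have -> : 1 - -1 * (1 + t) = 2%:R + t by ring.
  by rewrite (dabs_dom hN) dabs2 // (le_lt_trans t4).
have -> : 1 - 3%:R * (1 + t) = - (2%:R + 3%:R * t) by ring.
rewrite (dabsN hN) (dabs_dom hN) dabs2 // (dabsM hN); apply: le_lt_trans (_ :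
  4%:R^-1 < _) => //.
by apply: le_trans t4; rewrite ler_piMl // (dabs_ge0 hN).
Qed.

Lemma dabs_sqrt_base (i : F) : i = -1 \/ i = 3%:R -> N i = 1.
Proof.
move=> hi; have := dabs_one_sub hi (dabs1 hN); rewrite expr1n mulr1 => h.
have -> : i = 1 - (1 - i) by ring.
by rewrite (dabs_dom hN) ?(dabs1 hN) // (dabsN hN) h.
Qed.

End unit_squares.

(** * Minimal subsystems and the invariant measure *)

Section minimal_subsystems.
Variables (a b c d w eps j beta eta : Q2).
Local Notation dQ2 := dyadic_absQ2.
Local Notation ballP := (chart_ball absQ2 beta eta : nat -> PQ2 -> PQ2 -> bool).
Local Notation phi := (mobius a b c d).
Hypotheses (det0 : a * d - b * c != 0) (c0 : c != 0) (w0 : w != 0)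
  (Neps : absQ2 eps = 1) (Nj : absQ2 (1 - j) = 2%:R^-1)
  (DeltaE : (d - a) ^+ 2 + 4%:R * b * c = w ^+ 2 * j) (etaE : c * eta = w * eps)
  (betaE : 2%:R * c * beta = a - d - w)
  (u_neq0 : forall k, (0 < k)%N -> (mob_pow a b c d k).1 != 0).

Let eta0 : eta != 0.
Proof.
have : c * eta != 0 by rewrite etaE; apply: mulf_neq0 => //; rewrite -absQ2_gt0 Neps.
by apply: contraNneq => ->; rewrite mulr0.
Qed.

Let frame := chart_ball_frame beta eta0 : ball_frame ballP (chart_net beta eta).

Let phiE n (p q : PQ2) : ballP n (phi p) (phi q) = ballP n p q.
Proof. exact: (chart_ball_mob dQ2 det0 c0 w0 Neps Nj DeltaE etaE betaE). Qed.

Variable B : set PQ2.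
Hypothesis hB : minimal_subsystem phi B.

Lemma minimal_contains_ball : exists n p, [set q | ballP n p q] `<=` B.
Proof.
(* Recurrence is used at level 1, that is, distance at most 1/16, the threshold of
   [cross_dist_double]. *)
have [[[p Bp] _ _] Bmin] := hB; have [k k0 kp] := isometry_recurrence frame phiE 1 p.
have [m mP] := chart_ball_orbit_dense dQ2 det0 c0 w0 Neps Nj DeltaE etaE betaE u_neq0 k0 kp.
exists m, p => q /mP qP; rewrite (Bmin _ Bp) => U.
rewrite nbhsE => -[V [oV Vq] VU].
have [n nV] := chart_ball_base beta eta0 oV Vq; have [k' k'q] := qP n.
exists (iter k' phi p); split; first by exists k'.
by apply: VU; apply: nV; rewrite /= (chart_ball_sym dQ2).
Qed.

Variables (R : realType) (mu0 : probability Q2_borel R) (hmu0 : haar_Z2 mu0).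
Local Notation h := (PQ2_affine eta beta).

(** [PQ2_inv] maps exactly 2 Z_2 to the complement of Z_2: |1/z| > 1 means |z| < 1, hence |z| <=
    1/2, and 0 goes to infinity. *)
Let mubarE (A : set PQ2) : mubar mu0 (h @^-1` A) =
  (2^-1%:E * mu0 (Z2 `&` inner_pt beta eta @^-1` A)
     + mu0 (closed_ballQ2 0%R 1 `&` outer_pt beta eta @^-1` A))%E.
Proof.
rewrite /mubar; congr (_ * mu0 _ + mu0 _)%E; apply/seteqP; split => z /=.
- by move=> [[z' zZ [<-]]].
- by move=> [zZ Az]; split => //; exists z.
- rewrite /PQ2_inv /mobius mul1r addr0 /outer_pt; have [-> [_ Ah]|z0] := eqVneq z 0.
    by split => //; rewrite /closed_ballQ2 /= subrr absQ2_0 expr1 invr_ge0.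
  rewrite mul0r add0r mul1r => -[nZ Ah]; split => //.
  rewrite /closed_ballQ2 /= sub0r absQ2N; apply: (dabs_lt_half dQ2); rewrite expr0.
  rewrite ltNge; apply/negP => z1; apply: nZ; exists z^-1 => //.
  by rewrite /Z2 /= (dabsV dQ2) invf_le1 // absQ2_gt0.
- rewrite /PQ2_inv /mobius mul1r addr0 /outer_pt; have [-> [_ Ah]|z0] := eqVneq z 0.
    by split => // -[].
  rewrite mul0r add0r mul1r => -[z2 Ah]; split => //.
  move=> [z' zZ [E]]; move: z2 zZ; rewrite E /closed_ballQ2 /Z2 /= sub0r absQ2N expr1.
  rewrite (dabsV dQ2) => z2; rewrite invf_le1 ?absQ2_gt0 // => z1.
  by have := le_trans z1 z2.
Qed.

Lemma minimal_unique_invariant : exists sigma : probability PQ2_borel R,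
  unique_invariant_prob phi B sigma /\
  forall A : set PQ2_borel, measurable A -> A `<=` B ->
    sigma A = (mubar mu0 (h @^-1` A) / mubar mu0 (h @^-1` B))%E.
Proof.
have [mu [muE muball]] := chart_measure_exists beta eta0 hmu0.
have [[B0 _ phiB] Bmin] := hB.
have mB := measurable_minimal B0 Bmin.
have mu_fin : (mu setT < +oo)%E.
  rewrite muE !preimage_setT !setIT hmu0.1 (haar_Z2_ball 1 hmu0); last first.
    by rewrite /Z2 /= absQ2_0.
  by rewrite mule1 -EFinD ltry.
have muB : (0 < mu B)%E.
  have [n [p npB]] := minimal_contains_ball.
  apply: lt_le_trans (_ : (mu [set q | ballP n p q] <= _)%E).
    by rewrite muball lte_fin exprn_gt0 // invr_gt0.
  by apply: le_measure; rewrite ?inE //; exact: (measurable_ball frame).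
have mu_phi n p : mu [set q | ballP n (phi p) q] = mu [set q | ballP n p q].
  by rewrite !muball.
have [sigma [sI sE]] := minimal_invariant_exists frame phiE
  (fun p => mob_surj p det0) B0 phiB Bmin mu_fin mu_phi muB.
exists sigma; split; last by move=> A mA AB; rewrite !mubarE -!muE; exact: sE.
split; first exact: sI.
move=> tau tI A mA _.
exact: (invariant_on_unique frame phiE B0 phiB Bmin tI sI).
Qed.

End minimal_subsystems.

Section arithmetic.
Variables (R : realType) (a b c d Delta : Q2) (L : fieldExtType Q2) (s : L)
  (absL : L -> R) (i : Q2) (t : L).
Hypotheses (hDelta : Delta = (d - a) ^+ 2 + 4%:R * b * c) (hs : s ^+ 2 = Delta%:A)
  (hsQ2 : s \notin 1%VS) (habsL : extends_absQ2 absL)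
  (hi : i = - 1 \/ i = 3%:R) (ht : t ^+ 2 = i%:A) (hfield : <<1; s>>%VS = <<1; t>>%VS).

(** As [|i| = 1], [|s| ^ 2 = |Delta| = |q| ^ 2]. Hence [|s|] is a power of 2 and its valuation is an
    integer. *)
Lemma sqrt_Delta_form : exists q, [/\ q != 0,
  Delta = q ^+ 2 * i & absL s = ratr (absQ2 q)].
Proof.
have [q [sE DE]] := sqrt_mul Q2_two_neq0 hs ht hsQ2 hfield; exists q.
have q0 : q != 0.
  by apply: contraNneq hsQ2 => q0; rewrite sE q0 scale0r mul0r mem0v.
split => //; have [abs0 _ absM _ absE] := habsL.
have : absL s ^+ 2 = ratr (absQ2 q) ^+ 2.
  rewrite expr2 -absM -expr2 hs absE DE absQ2M (dabsX dyadic_absQ2).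
  by rewrite (dabs_sqrt_base dyadic_absQ2 hi) mulr1 rmorphXn.
by move/eqP; rewrite eqrXn2 // => [/eqP//|]; rewrite ler0q absQ2_ge0.
Qed.

(** For [c = 0] the discriminant would be the square [(d - a) ^ 2]. *)
Lemma lower_entry_neq0 : c != 0.
Proof.
apply: contraNneq hsQ2 => c0; move: hs; rewrite hDelta c0 mulr0 addr0 => s2.
have : s ^+ 2 = ((d - a)%:A) ^+ 2 by rewrite s2 -[LHS]/(in_alg L _) rmorphXn.
move/eqP; rewrite eqf_sqr => /orP[] /eqP ->; first by apply/vlineP; exists (d - a).
by apply/vlineP; exists (- (d - a)); rewrite scaleNr.
Qed.

End arithmetic.

Theorem theorem6p7
  (R : realType)
  (* the Haar probability measure on Z_2 *)
  (mu0 : probability Q2_borel R) (hmu0 : haar_Z2 mu0)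
  (a b c d : Q2) (hdet : a * d - b * c != 0)
  (Delta : Q2) (hDelta : Delta = (d - a) ^+ 2 + 4%:R * b * c)
  (* an extension of Q_2 containing s = sqrt Delta and t = sqrt i *)
  (L : fieldExtType Q2) (s : L) (hs : s ^+ 2 = Delta%:A)
  (hsQ2 : s \notin 1%VS)
  (absL : L -> R) (habsL : extends_absQ2 absL)
  (lambda : L)
  (hlambda : lambda = ((a + d)%:A + s) / ((a + d)%:A - s))
  (hroot : forall n : nat, (0 < n)%N -> lambda ^+ n <> 1)
  (i : Q2) (hi : i = - 1 \/ i = 3%:R)
  (t : L) (ht : t ^+ 2 = i%:A)
  (hfield : <<1; s>>%VS = <<1; t>>%VS)
  (r0 : R) (hr0 : r0 = absL (s / c%:A))
  (eta : Q2) (heta : ratr (absQ2 eta) = r0)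
  (* v_2(sqrt Delta) is an integer, so that taking its floor only changes
     its type *)
  (v : int) (hv : v = Num.floor (valuation2 absL s))
  (h : PQ2 -> PQ2)
  (hh : h = PQ2_affine eta ((a - d - 2%:R ^ v) / (2%:R * c)))
  (B : set PQ2) (hB : minimal_subsystem (mobius a b c d) B) :
  exists sigma : probability PQ2_borel R,
    unique_invariant_prob (mobius a b c d) B sigma /\
    forall A : set PQ2_borel, measurable A -> A `<=` B ->
      sigma A = (mubar mu0 (h @^-1` A) / mubar mu0 (h @^-1` B))%E.
Proof.
have [q [q0 DE sE]] := sqrt_Delta_form hs hsQ2 habsL hi ht hfield.
have c0 := lower_entry_neq0 hDelta hs hsQ2.
have [m qm] := absQ2_exp2 q0.
have two := Q2_two_neq0.
have vE : v = - m.
  by rewrite hv; apply: floor_valuation2; rewrite sE qm ratr_exp2.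
set w : Q2 := 2%:R ^ v.
have w0 : w != 0 by rewrite expfz_neq0.
have wE : absQ2 w = absQ2 q.
  by rewrite /w (dabs_two_expz dyadic_absQ2) vE opprK qm.
have cN : absQ2 c != 0 by rewrite (dabs_eq0 dyadic_absQ2).
have etaE : absQ2 eta = absQ2 q / absQ2 c.
  have [_ _ absM _ absE] := habsL.
  have cA : c%:A != 0 :> L by rewrite -[c%:A]/(in_alg L c) fmorph_eq0.
  have /eqP : absL (s / c%:A) * absL c%:A = absL s by rewrite -absM divfK.
  rewrite -hr0 -heta absE sE -rmorphM (inj_eq (fmorph_inj (ratr : {rmorphism rat -> R}))).
  by move=> /eqP <-; rewrite mulfK.
have wN : absQ2 w != 0 by rewrite (dabs_eq0 dyadic_absQ2).
(* [c * eta / w] and [q / w] are units because [w], [q] and sqrt Delta have the same absolute value;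
   the second makes [j] equal to [i] times the square of a unit. *)
rewrite hh; apply: (@minimal_unique_invariant a b c d w (c * eta / w) (i * (q / w) ^+ 2)) => //.
- by rewrite !absQ2M (dabsV dyadic_absQ2) etaE wE mulrCA divff // mulr1 divff // -wE.
- apply: (dabs_one_sub dyadic_absQ2) => //.
  by rewrite absQ2M (dabsV dyadic_absQ2) wE divff // -wE.
- by rewrite -hDelta DE expr_div_n mulrCA [w ^+ 2 * _]mulrC divfK ?expf_neq0 // mulrC.
- by rewrite [RHS]mulrC divfK.
- by rewrite mulrC divfK // mulf_neq0.
- have s2 : s ^+ 2 = in_alg L ((d - a) ^+ 2 + 4%:R * b * c) by rewrite hs hDelta.
  exact: (@mob_pow_neq0 _ L (in_alg L) a b c d s lambda two hdet s2 hlambda hroot).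
Qed.
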